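(* Let $x=u+u^*\in\mathcal{A}_0=C_r^*(G)$, where $G=L\rtimes\mathbb{Z}$, $L=\bigoplus_{k\in\mathbb{Z}}\Lambda$, and let $\mathcal{B}_0=C_r^*(L)$. For every $b\in\mathcal{B}_0$ with $\|b\|<1/2$, $$R_x^{\mathcal{B}_0}(b)=\sum_{m\ge0}(-1)^mC_m\left((\alpha(b)b)^m\alpha(b)+(\alpha^{-1}(b)b)^m\alpha^{-1}(b)\right)$$ $$=2\alpha(b)\bigl(1+\sqrt{1+4b\alpha(b)}\bigr)^{-1}+2\alpha^{-1}(b)\bigl(1+\sqrt{1+4b\alpha^{-1}(b)}\bigr)^{-1},$$ where the square roots are the principal square roots given by functional calculus.
   Context: $\Lambda$ is a finitely generated abelian group, $L=\bigoplus_{k\in\mathbb{Z}}\Lambda$ is the group of finitely supported functions $\mathbb{Z}\to\Lambda$, with identity $e_L$, and $G=L\rtimes\mathbb{Z}$ has product $(f,g)(f',g')=(f\cdot f'(\cdot-g),g+g')$; $L$ is identified with $L\times\{0\}\le G$. $\lambda_G$ is the left regular representation on $\ell^2(G)$, $\mathcal{A}_0=C_r^*(G)$ is the norm closure of $\lambda_G(\mathbb{C}[G])$, and $\mathcal{B}_0=C_r^*(L)\subset\mathcal{A}_0$ (canonical inclusion). $E_L:\mathcal{A}_0\to\mathcal{B}_0$ is the conditional expectation determined by $E_L(\lambda_G(h))=\lambda_G(h)$ if $h\in L$ and $0$ if $h\in G\setminus L$. Let $u=\lambda_G(e_L,1)$ and $\alpha(b)=ubu^*$ for $b\in\mathcal{B}_0$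 (an automorphism of $\mathcal{B}_0$). $C_m=\frac1{m+1}\binom{2m}{m}$ is the $m$-th Catalan number. The $\mathcal{B}_0$-valued free cumulants $\kappa_n^{\mathcal{B}_0}:\mathcal{A}_0^n\to\mathcal{B}_0$ of the operator-valued probability space $(\mathcal{A}_0,\mathcal{B}_0,E_L)$ are defined by $E_L(a_1\cdots a_n)=\sum_{\pi\in NC(n)}\kappa_\pi^{\mathcal{B}_0}(a_1,\dots,a_n)$ for all $n$, where $NC(n)$ is the set of non-crossing partitions of $\{1,\dots,n\}$, $\kappa_{1_n}=\kappa_n$ for the one-block partition $1_n$, and for $\pi\neq 1_n$ with an interval block $W=\{q+1,\dots,q+l\}$, $\kappa_\pi(a_1,\dots,a_n)=\kappa_{\pi\setminus W}(a_1,\dots,a_q\,\kappa_l(a_{q+1},\dots,a_{q+l}),a_{q+l+1},\dots,a_n)$ (when $q=0$ the factor $\kappa_l(\dots)$ multiplies on the left). The $R$-transform is $R_x^{\mathcal{B}_0}(b)=\sum_{n\ge0}\kappa_{n+1}^{\mathcal{B}_0}(xb,\dots,xb,x)$ (with $n$ arguments $xb$ followed by $x$). *)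

(* Defs.v *)
From HB Require Import structures.
From mathcomp Require Import all_boot all_order all_algebra.
From mathcomp Require Import finmap complex.
From mathcomp Require Import all_classical all_reals all_analysis.
From mathcomp Require Import summability ring lra.

Set Implicit Arguments.
Unset Strict Implicit.
Unset Printing Implicit Defensive.

Import Order.TTheory GRing.Theory Num.Theory.
Import numFieldNormedType.Exports.
Import ComplexField.Normc.

Local Open Scope classical_set_scope.
Local Open Scope ring_scope.

Lemma normc_ge0 (R : realType) (z : R[i]) : 0 <= normc z.
Proof. by case: z => a b; exact: sqrtr_ge0. Qed.

Section SquareSummable.
Variables (R : realType) (G : choiceType).
Implicit Types (f g : G -> R[i]^o) (c : R[i]).

Definition sqnorm f : \bar R := \esum_(x in setT) (normc (f x) ^+ 2)%:E.

Definition sqsummable : {pred G -> R[i]^o} := [pred f | (sqnorm f < +oo)%E].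

Lemma sqnorm_ge0 f : (0 <= sqnorm f)%E.
Proof. by apply: esum_ge0 => x _; rewrite lee_fin sqr_ge0. Qed.

Lemma sqnorm_ge f x : ((normc (f x) ^+ 2)%:E <= sqnorm f)%E.
Proof.
rewrite -(@esum_set1 _ _ x (fun y => (normc (f y) ^+ 2)%:E)) ?lee_fin ?sqr_ge0//.
rewrite esum_mkcond; apply: le_esum => y _.
by case: ifP => // _; rewrite lee_fin sqr_ge0.
Qed.

Lemma ge0_esumZl (k : R) (a : G -> \bar R) : (0 < k)%R ->
  (forall x, 0 <= a x)%E ->
  (\esum_(x in setT) (k%:E * a x) = k%:E * \esum_(x in setT) a x)%E.
Proof.
move=> k0 a0; rewrite /esum -ereal_sup_pZl//; congr ereal_sup.
apply/seteqP; split=> [_ [A Af <-]|_ [_ [A Af <-] <-]] /=.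
  by exists (\sum_(x \in A) a x)%E; [exists A|rewrite ge0_mule_fsumr].
by exists A => //; rewrite ge0_mule_fsumr.
Qed.

Lemma sqnormZ c f : sqnorm (c *: f) = ((normc c ^+ 2)%:E * sqnorm f)%E.
Proof.
have [->|c0] := eqVneq c 0.
  rewrite scale0r normc0 expr0n/= mul0e /sqnorm.
  by apply: esum1 => x _; rewrite normc0 expr0n.
rewrite /sqnorm -ge0_esumZl.
- by apply: eq_esum => x _; rewrite normcM exprMn EFinM.
- rewrite exprn_gt0// lt_def; apply/andP; split; last first.
    exact: normc_ge0.
  by apply: contra_neq c0; exact: eq0_normc.
- by move=> x; rewrite lee_fin sqr_ge0.
Qed.

Lemma sqnormD_le f g (t : R) : (0 < t)%R ->
  (sqnorm (f + g)%R <= (1 + t)%:E * sqnorm f + (1 + t^-1)%:E * sqnorm g)%E.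
Proof.
move=> t0; rewrite /sqnorm -!ge0_esumZl ?addr_gt0 ?invr_gt0//;
  do ?[by move=> x; rewrite lee_fin sqr_ge0].
rewrite -esumD => [|x _|x _]; last 2 first.
- by rewrite -EFinM lee_fin mulr_ge0 ?sqr_ge0// addr_ge0 ?ltW.
- by rewrite -EFinM lee_fin mulr_ge0 ?sqr_ge0// addr_ge0 ?invr_ge0 ?ltW.
apply: le_esum => x _; rewrite -!EFinM -EFinD lee_fin.
have /= := le_normcD (f x) (g x).
rewrite -[(f + g) x]/(f x + g x).
set p := normc (f x); set q := normc (g x) => pq.
have p0 : 0 <= p by exact: normc_ge0.
have q0 : 0 <= q by exact: normc_ge0.
apply: (@le_trans _ _ ((p + q) ^+ 2)).
  by rewrite ler_sqr ?nnegrE ?addr_ge0// normc_ge0.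
have -> : (1 + t) * p ^+ 2 + (1 + t^-1) * q ^+ 2 =
          (p + q) ^+ 2 + t^-1 * (t * p - q) ^+ 2.
  by field; rewrite gt_eqF.
by rewrite lerDl mulr_ge0 ?sqr_ge0// invr_ge0 ltW.
Qed.

Lemma sqsummable_submod_closed : submod_closed sqsummable.
Proof.
split=> [|c f g]; rewrite !inE.
  have -> : sqnorm 0 = 0%E by apply: esum1 => x _; rewrite normc0 expr0n.
  by rewrite ltry.
move=> f2 g2; apply: le_lt_trans (sqnormD_le _ _ ltr01) _.
rewrite sqnormZ; have := sqnorm_ge0 f; have := sqnorm_ge0 g.
case: (sqnorm f) f2 (sqnorm g) g2 => [u| |] //= _ [v| |] //= _ _ _.
by rewrite -!EFinM -EFinD ltry.
Qed.

HB.instance Definition _ := GRing.isSubmodClosed.Build R[i] (G -> R[i]^o)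
  sqsummable sqsummable_submod_closed.

End SquareSummable.

Record ell2 (R : realType) (G : choiceType) := Ell2 {
  ell2_fun :> G -> R[i]^o;
  ell2P : ell2_fun \in @sqsummable R G }.

Section Ell2.
Variables (R : realType) (G : choiceType).

HB.instance Definition _ := [isSub for @ell2_fun R G].
HB.instance Definition _ := [Choice of ell2 R G by <:].
HB.instance Definition _ := [SubChoice_isSubLmodule of ell2 R G by <:].

Implicit Types f g : ell2 R G.

(* Norms on a normedModType over R[i] take values in R[i]; rnorm and opnorm
   below are the corresponding real numbers. *)
Definition ell2_norm f : R[i] := (Num.sqrt (fine (sqnorm f)))%:C%C.

Lemma ell2_norm_subproof f : sqnorm f = (Num.sqrt (fine (sqnorm f)) ^+ 2)%:E.
Proof.
have := ell2P f; rewrite inE => f2.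
by rewrite sqr_sqrtr ?fine_ge0 ?sqnorm_ge0// fineK// ge0_fin_numE ?sqnorm_ge0.
Qed.

Lemma ell2_norm0_eq0 f : ell2_norm f = 0 -> f = 0.
Proof.
move=> /complexI f0; apply/val_inj/funext => x /=.
apply: eq0_normc; apply/eqP; rewrite -sqrf_eq0 eq_le sqr_ge0 andbT.
by rewrite -lee_fin (le_trans (sqnorm_ge f x))// ell2_norm_subproof f0 expr0n.
Qed.

Lemma ell2_normD f g : ell2_norm (f + g) <= ell2_norm f + ell2_norm g.
Proof.
have [/eqP/ell2_norm0_eq0->|f0] := boolP (ell2_norm f == 0).
  by rewrite add0r lerDr lecR sqrtr_ge0.
have [/eqP/ell2_norm0_eq0->|g0] := boolP (ell2_norm g == 0).
  by rewrite addr0 lerDl lecR sqrtr_ge0.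
rewrite /ell2_norm -rmorphD/= lecR.
have := ell2_norm_subproof f; have := ell2_norm_subproof g.
have := ell2_norm_subproof (f + g).
set a := Num.sqrt (fine (sqnorm f)); set b := Num.sqrt (fine (sqnorm g)).
set c := Num.sqrt _ => Ec Eb Ea.
have a0 : 0 < a.
  by rewrite lt_def sqrtr_ge0 andbT; apply: contra f0 => /eqP a0; rewrite /ell2_norm -/a a0.
have b0 : 0 < b.
  by rewrite lt_def sqrtr_ge0 andbT; apply: contra g0 => /eqP b0; rewrite /ell2_norm -/b b0.
have := sqnormD_le f g (divr_gt0 b0 a0).
rewrite -[(f : G -> R[i]^o) + g]/(ell2_fun (f + g)) Ec Eb Ea.
rewrite -!EFinM -EFinD lee_fin.
have -> : (1 + b / a) * a ^+ 2 + (1 + (b / a)^-1) * b ^+ 2 = (a + b) ^+ 2.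
  by field; rewrite !gt_eqF.
by rewrite ler_sqr ?nnegrE ?addr_ge0 ?sqrtr_ge0.
Qed.

Lemma ell2_normZ (c : R[i]) f : ell2_norm (c *: f) = `|c| * ell2_norm f.
Proof.
have nc : `|c| = (normc c)%:C%C by [].
have c0 : 0 <= normc c by rewrite -lecR -nc normr_ge0.
rewrite nc /ell2_norm -rmorphM/=; congr (_%:C%C).
have -> : sqnorm (c *: f) = sqnorm (c *: (f : G -> R[i]^o)) by [].
rewrite sqnormZ fineM//.
  by rewrite sqrtrM ?sqr_ge0// sqrtr_sqr ger0_norm.
by rewrite ell2_norm_subproof.
Qed.

HB.instance Definition _ := Lmodule_isNormed.Build R[i] (ell2 R G)
  ell2_normD ell2_normZ ell2_norm0_eq0.

End Ell2.

Section BoundedOperators.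
Variables (R : realType) (G : groupType).
Local Notation C := R[i].
Local Notation V := (ell2 R G).
Implicit Types (T : V -> V) (x : V).

Definition rnorm x : R := complex.Re `|x|.

Lemma rnormE x : `|x| = (rnorm x)%:C%C. Proof. by []. Qed.

Lemma rnorm_ge0 x : 0 <= rnorm x. Proof. exact: sqrtr_ge0. Qed.

Lemma rnorm0 : rnorm 0 = 0. Proof. by rewrite /rnorm normr0. Qed.

Lemma rnormZ (c : C) x : rnorm (c *: x) = normc c * rnorm x.
Proof. by apply: complexI; rewrite -rnormE normrZ rmorphM. Qed.

Lemma rnormD x y : rnorm (x + y) <= rnorm x + rnorm y.
Proof. by rewrite -lecR rmorphD /= -!rnormE ler_normD. Qed.

Definition bounded_linear : {pred V -> V} := [pred T | `[< linear T /\
  exists M : R, forall x, rnorm (T x) <= M * rnorm x >]].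

Lemma bounded_linear_submod_closed : submod_closed bounded_linear.
Proof.
split=> [|c S T].
  apply/asboolP; split; first by move=> c x y; rewrite scaler0 addr0.
  by exists 0 => x; rewrite mul0r rnorm0.
move=> /asboolP[Sl [M SM]] /asboolP[Tl [N TN]]; apply/asboolP; split.
  move=> k x y; rewrite -[(_ + T) _]/(c *: S _ + T _) Sl Tl.
  rewrite -[(_ + T) x]/(c *: S x + T x) -[(_ + T) y]/(c *: S y + T y).
  by rewrite !scalerDr !scalerA mulrC addrACA.
exists (normc c * M + N) => x; rewrite -[(_ + T) x]/(c *: S x + T x).
rewrite (le_trans (rnormD _ _))// rnormZ mulrDl lerD// -mulrA ler_wpM2l//.
exact: normc_ge0.
Qed.

HB.instance Definition _ := GRing.isSubmodClosed.Build C (V -> V)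
  bounded_linear bounded_linear_submod_closed.

End BoundedOperators.

Record bop (R : realType) (G : groupType) := Bop {
  bop_fun :> ell2 R G -> ell2 R G;
  bopP : bop_fun \in @bounded_linear R G }.

Section BopNormed.
Variables (R : realType) (G : groupType).
Local Notation C := R[i].
Local Notation V := (ell2 R G).

HB.instance Definition _ := [isSub for @bop_fun R G].
HB.instance Definition _ := [Choice of bop R G by <:].
HB.instance Definition _ := [SubChoice_isSubLmodule of bop R G by <:].

Implicit Types (S T : bop R G) (x y : V).

Lemma bop_linear T : linear T.
Proof. by have /asboolP[] := bopP T. Qed.

HB.instance Definition _ T := GRing.isLinear.Build C V V *:%R T (bop_linear T).

Definition opnorm T : R := sup [set rnorm (T x) | x in [set x | rnorm x <= 1]].

Lemma opnorm_has_sup T :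
  has_sup [set rnorm (T x) | x in [set x | rnorm x <= 1]].
Proof.
have /asboolP[_ [M TM]] := bopP T; split.
  exists (rnorm (T 0)); exists 0 => //=.
  by rewrite rnorm0 ler01.
exists `|M| => _ [x /= x1 <-]; rewrite (le_trans (TM x))//.
rewrite (le_trans (ler_norm _))// normrM ler_piMr//.
by rewrite ger0_norm// rnorm_ge0.
Qed.

Lemma opnorm_ge0 T : 0 <= opnorm T.
Proof.
have /ubP ub := sup_upper_bound (opnorm_has_sup T).
apply: (le_trans (rnorm_ge0 (T 0))); apply: ub; exists 0 => //=.
by rewrite rnorm0 ler01.
Qed.

Lemma opnormP T x : rnorm (T x) <= opnorm T * rnorm x.
Proof.
have [/eqP x0|x0] := boolP (rnorm x == 0).
  have -> : x = 0 by apply/eqP; rewrite -normr_eq0 rnormE x0.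
  by rewrite linear0 rnorm0 mulr0.
have {}x0 : 0 < rnorm x by rewrite lt_def x0 rnorm_ge0.
rewrite -ler_pdivrMr//.
have nx : normc ((rnorm x)^-1)%:C%C = (rnorm x)^-1.
  by rewrite /= expr0n/= addr0 sqrtr_sqr ger0_norm// invr_ge0 ltW.
have /ubP ub := sup_upper_bound (opnorm_has_sup T).
apply: ub; exists (((rnorm x)^-1)%:C%C *: x) => /=.
  by rewrite rnormZ nx mulVf// gt_eqF.
by rewrite linearZ/= rnormZ nx mulrC.
Qed.

Lemma opnorm_le T (M : R) : 0 <= M ->
  (forall x, rnorm (T x) <= M * rnorm x) -> opnorm T <= M.
Proof.
move=> M0 TM; apply: ge_sup; first by case: (opnorm_has_sup T).
by move=> _ [x /= x1 <-]; rewrite (le_trans (TM x))// ler_piMr.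
Qed.

Lemma bopD S T x : (S + T) x = S x + T x. Proof. by []. Qed.

Lemma bopZ (c : C) T x : (c *: T) x = c *: T x. Proof. by []. Qed.

Definition bop_norm T : C := (opnorm T)%:C%C.

Lemma bop_normD S T : bop_norm (S + T) <= bop_norm S + bop_norm T.
Proof.
rewrite /bop_norm -rmorphD lecR opnorm_le ?addr_ge0 ?opnorm_ge0// => x.
by rewrite bopD (le_trans (rnormD _ _))// mulrDl lerD// opnormP.
Qed.

Lemma bop_normZ_le (c : C) T : opnorm (c *: T) <= normc c * opnorm T.
Proof.
have c0 := normc_ge0 c.
rewrite opnorm_le ?mulr_ge0 ?opnorm_ge0// => x.
by rewrite bopZ rnormZ -mulrA ler_wpM2l// opnormP.
Qed.

Lemma bop_normZ (c : C) T : bop_norm (c *: T) = `|c| * bop_norm T.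
Proof.
have -> : `|c| = (normc c)%:C%C by [].
rewrite /bop_norm -rmorphM; congr (_%:C%C).
have [->|c0] := eqVneq c 0.
  rewrite normc0 mul0r; apply/eqP; rewrite eq_le opnorm_ge0 andbT.
  by rewrite (le_trans (bop_normZ_le _ _))// normc0 mul0r.
apply/eqP; rewrite eq_le bop_normZ_le /=.
have := bop_normZ_le c^-1 (c *: T); rewrite scalerA mulVf// scale1r normcV.
rewrite mulrC ler_pdivlMr 1?mulrC// lt_def; apply/andP; split.
  by apply: contra_neq c0; exact: eq0_normc.
exact: normc_ge0.
Qed.

Lemma bop_norm0_eq0 T : bop_norm T = 0 -> T = 0.
Proof.
move=> /complexI T0; apply/val_inj/funext => x /=.
apply/eqP; rewrite -normr_eq0 rnormE; apply/eqP; congr (_%:C%C).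
by apply/eqP; rewrite eq_le rnorm_ge0 andbT (le_trans (opnormP T x))// T0 mul0r.
Qed.

HB.instance Definition _ := Lmodule_isNormed.Build C (bop R G)
  bop_normD bop_normZ bop_norm0_eq0.

Lemma bop_one_subproof : @idfun V \in @bounded_linear R G.
Proof. by apply/asboolP; split => //; exists 1 => x; rewrite mul1r. Qed.

Lemma bop_comp_subproof S T : S \o T \in @bounded_linear R G.
Proof.
apply/asboolP; split; first by move=> c x y /=; rewrite !linearP.
exists (opnorm S * opnorm T) => x /=.
rewrite (le_trans (opnormP _ _))// -mulrA ler_wpM2l ?opnorm_ge0//.
exact: opnormP.
Qed.

Definition bop_one : bop R G := Bop bop_one_subproof.
Definition bop_comp S T : bop R G := Bop (bop_comp_subproof S T).

Lemma bop_compA : associative bop_comp.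
Proof. by move=> S T U; exact: val_inj. Qed.

Lemma bop_comp1l : left_id bop_one bop_comp.
Proof. by move=> T; exact: val_inj. Qed.

Lemma bop_comp1r : right_id bop_one bop_comp.
Proof. by move=> T; exact: val_inj. Qed.

Lemma bop_compDl : left_distributive bop_comp +%R.
Proof. by move=> S T U; exact: val_inj. Qed.

Lemma bop_compDr : right_distributive bop_comp +%R.
Proof.
move=> S T U; apply/val_inj/funext => x /=.
by rewrite [LHS]raddfD.
Qed.

Definition ell2_delta_fun (g : G) : G -> C^o := fun h => (h == g)%:R.

Lemma ell2_delta_subproof (g : G) : ell2_delta_fun g \in @sqsummable R G.
Proof.
rewrite inE /sqnorm (_ : \esum_(x in _) _ = 1%:E) ?ltry//.
rewrite -(@esum_set1 _ _ g (fun=> 1%:E)) ?lee_fin// [RHS]esum_mkcond.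
apply: eq_esum => x _; rewrite /ell2_delta_fun; case: eqVneq => [->|/eqP xg].
  by rewrite mem_set// normc1 expr1n.
by rewrite memNset// normc0 expr0n.
Qed.

Definition ell2_delta (g : G) : V := Ell2 (ell2_delta_subproof g).

Lemma bop_one_neq0 : bop_one != 0.
Proof.
apply/eqP => /(congr1 (fun T : bop R G => T (ell2_delta 1%g) 1%g)).
rewrite -[LHS]/((1%g == 1%g :> G)%:R) eqxx => /eqP.
by rewrite -[X in _ == X]/(0 : C) oner_eq0.
Qed.

HB.instance Definition _ := GRing.Zmodule_isNzRing.Build (bop R G)
  bop_compA bop_comp1l bop_comp1r bop_compDl bop_compDr bop_one_neq0.

Lemma bop_scaleAl (c : C) S T : c *: (S * T) = (c *: S) * T.
Proof. exact: val_inj. Qed.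

HB.instance Definition _ := GRing.Lmodule_isLalgebra.Build C (bop R G)
  bop_scaleAl.

Lemma bop_scaleAr (c : C) S T : c *: (S * T) = S * (c *: T).
Proof. by apply/val_inj/funext => x /=; rewrite [RHS]linearZ. Qed.

HB.instance Definition _ := GRing.Lalgebra_isAlgebra.Build C (bop R G)
  bop_scaleAr.

Definition bop_unit : {pred bop R G} :=
  [pred T | `[< exists S, S * T = 1 /\ T * S = 1 >]].

Definition bop_inv T : bop R G := xget T [set S | S * T = 1 /\ T * S = 1].

Lemma bop_mulVr : {in bop_unit, left_inverse 1 bop_inv *%R}.
Proof. by move=> T /asboolP exS; have [] := xgetPex T exS. Qed.

Lemma bop_mulrV : {in bop_unit, right_inverse 1 bop_inv *%R}.
Proof. by move=> T /asboolP exS; have [] := xgetPex T exS. Qed.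

Lemma bop_unitP S T : T * S = 1 /\ S * T = 1 -> bop_unit S.
Proof. by move=> ST; apply/asboolP; exists T. Qed.

Lemma bop_inv_out : {in [predC bop_unit], bop_inv =1 id}.
Proof.
move=> T /asboolP nS; rewrite /bop_inv; case: xgetP => // S _ ST.
by case: nS; exists S.
Qed.

HB.instance Definition _ := GRing.NzRing_hasMulInverse.Build (bop R G)
  bop_mulVr bop_mulrV bop_unitP bop_inv_out.

End BopNormed.

Section Representation.
Variables (R : realType) (G : groupType).
Local Notation C := R[i].
Local Notation V := (ell2 R G).

(* Unordered sum over G, linear in the first argument. *)
Definition inner (x y : V) : C^o :=
  sum (fun g => x g * (y g)^*%C : C^o).

(* The adjoint of a bounded operator exists and is unique, so the default
   value 0 is never used. *)
Definition adjoint (T : bop R G) : bop R G :=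
  xget 0 [set S : bop R G | forall x y, inner (T x) y = inner x (S y)].

Lemma lambda_sqnorm (g : G) (f : G -> C^o) :
  sqnorm (fun h => f (g^-1 * h)%g) = sqnorm f.
Proof.
rewrite /sqnorm [RHS](reindex_esum setT setT (fun h => g^-1 * h)%g)//.
- split => // [h1 h2 _ _ /= /(congr1 (fun h => g * h)%g)|h _].
    by rewrite !mulVKg.
  by exists (g * h)%g => //; rewrite mulKg.
Qed.

Lemma lambda_subproof1 (g : G) (x : V) :
  (fun h => x (g^-1 * h)%g) \in @sqsummable R G.
Proof. by have := ell2P x; rewrite !inE lambda_sqnorm. Qed.

Definition lambda_fun (g : G) (x : V) : V := Ell2 (lambda_subproof1 g x).

Lemma lambda_subproof2 (g : G) : lambda_fun g \in @bounded_linear R G.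
Proof.
apply/asboolP; split; first by move=> c x y; exact: val_inj.
by exists 1 => x; rewrite mul1r /rnorm/= lambda_sqnorm.
Qed.

Definition lambda (g : G) : bop R G := Bop (lambda_subproof2 g).

(* lambda_span H is the image of the group algebra C[H] in the bounded
   operators on ell2 G. For a subgroup H its norm closure is the canonical
   copy of the reduced C*-algebra of H inside that of G. *)
Definition lambda_span (H : set G) : set (bop R G) :=
  [set T | exists2 s : seq (C * G), (forall p, p \in s -> H p.2) &
    T = \sum_(p <- s) p.1 *: lambda p.2].

Definition cstar (H : set G) : set (bop R G) := closure (lambda_span H).

Record is_cond_exp (H : set G) (E : bop R G -> bop R G) : Prop := {
  cond_exp_range : forall a, cstar setT a -> cstar H (E a);
  cond_exp_linear : forall (c : C) a a', cstar setT a -> cstar setT a' ->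
    E (c *: a + a') = c *: E a + E a';
  cond_exp_contractive : forall a, cstar setT a -> `|E a| <= `|a|;
  cond_exp_proj : forall b, cstar H b -> E b = b;
  cond_exp_bimod : forall b a b', cstar H b -> cstar setT a -> cstar H b' ->
    E (b * a * b') = b * E a * b';
  cond_exp_in : forall h, H h -> E (lambda h) = lambda h;
  cond_exp_out : forall h, ~ H h -> E (lambda h) = 0 }.

Definition spectrum (a : bop R G) : set C^o :=
  [set z | a - z%:A \isn't a GRing.unit].

(* The continuous functional calculus of a: the isometric unital *-homomorphism
   from the continuous functions on the spectrum of a which sends the identity
   function to a. Such a function is given here by any function on the complex
   plane whose restriction to the spectrum is continuous. The principal square root
   is complex.sqrtc (real part >= 0), not sqrtC (imaginary part >= 0). *)
Record is_functional_calculus (a : bop R G)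
    (Phi : (C^o -> C^o) -> bop R G) : Prop := {
  fcalc_one : Phi (fun=> 1) = 1;
  fcalc_id : Phi (fun z => z) = a;
  fcalc_linear : forall (c : C) (f g : C^o -> C^o), {within spectrum a, continuous f} ->
    {within spectrum a, continuous g} -> Phi (fun z => c * f z + g z) = c *: Phi f + Phi g;
  fcalc_mul : forall f g : C^o -> C^o, {within spectrum a, continuous f} ->
    {within spectrum a, continuous g} -> Phi (fun z => f z * g z) = Phi f * Phi g;
  fcalc_star : forall f : C^o -> C^o, {within spectrum a, continuous f} ->
    Phi (fun z => (f z)^*%C) = adjoint (Phi f);
  fcalc_isometric : forall f : C^o -> C^o, {within spectrum a, continuous f} ->
    `|Phi f| = (sup [set normc (f z) | z in spectrum a])%:C%C }.

End Representation.

Section FreeCumulants.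
Variables (A : pzRingType) (A0 B0 : set A) (E : A -> A).

(* A partition P of a subset S of 'I_n is a finite set of blocks with
   cover P = S. Removing a block W from P leaves a partition of S minus W, so
   that no relabelling of the remaining indices is needed. *)
Definition noncrossing n (P : {set {set 'I_n}}) : bool :=
  [forall V in P, forall W in P, (V != W) ==>
    ~~ [exists i in V, exists j in W, exists k in V, exists l in W,
         [&& (i < j)%N, (j < k)%N & (k < l)%N]]].

Definition interval_block n (P : {set {set 'I_n}}) (W : {set 'I_n}) : bool :=
  (W \in P) && [forall i in W, forall k in W, forall j in finset.cover P,
    (i < j)%N && (j < k)%N ==> (j \in W)].

(* The arguments left after removing the interval block W of P, where c is the
   cumulant of W: the last index before W is multiplied on the right by c; when
   there is none, the first index after W is multiplied on the left by c. *)
Definition absorb n (P : {set {set 'I_n}}) (W : {set 'I_n}) (c : A)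
    (a : 'I_n -> A) (i : 'I_n) : A :=
  let S := (finset.cover P :\: W)%SET in
  if [&& i \in S, [forall w in W, (i < w)%N] &
      [forall j in S, [forall w in W, (j < w)%N] ==> (j <= i)%N]]
  then a i * c
  else if [&& i \in S, [forall w in W, (w < i)%N] & [forall j in S, (i <= j)%N]]
  then c * a i
  else a i.

Definition block_args n (a : 'I_n -> A) (W : {set 'I_n}) : seq A :=
  [seq a i | i <- enum W].

(* kappa s is the n-th cumulant at the entries of s, where n = size s, and
   kappa_part n P a is the multiplicative extension along the partition P. *)
Definition is_free_cumulants (kappa : seq A -> A) : Prop :=
  exists kappa_part : forall n, {set {set 'I_n}} -> ('I_n -> A) -> A,
  [/\ forall s, (0 < size s)%N -> {in s, forall x, A0 x} -> B0 (kappa s),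
      forall n (W : {set 'I_n}) a, (forall i, A0 (a i)) -> W != finset.set0 ->
        kappa_part n [set W]%SET a = kappa (block_args a W),
      forall n (P : {set {set 'I_n}}) W a, (forall i, A0 (a i)) ->
        finset.partition P (finset.cover P) -> noncrossing P ->
        interval_block P W -> P != [set W]%SET ->
        kappa_part n P a =
          kappa_part n (P :\ W)%SET (absorb P W (kappa (block_args a W)) a) &
      forall n a, (0 < n)%N -> (forall i, A0 (a i)) ->
        E (\prod_(i < n) a i) =
          \sum_(P | finset.partition P [set: 'I_n]%SET && noncrossing P)
            kappa_part n P a].

End FreeCumulants.

Definition finitely_generated (L : zmodType) : Prop :=
  exists s : seq L, forall x, exists c : nat -> int,
    x = \sum_(i < size s) s`_i *~ c i.

Section DirectSum.
Variable Lam : zmodType.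

Definition finsupp : {pred int -> Lam} :=
  [pred f : int -> Lam | `[< finite_set [set k | f k != 0] >]].

Lemma finsupp_zmod_closed : zmod_closed finsupp.
Proof.
split=> [|f g]; first by apply/asboolP; rewrite (_ : mkset _ = set0)//;
  apply/seteqP; split=> k //=; rewrite eqxx.
move=> /asboolP ff /asboolP fg; apply/asboolP.
have fU : finite_set ([set k | f k != 0] `|` [set k | g k != 0]).
  by rewrite finite_setU.
apply: sub_finite_set fU => k /=; rewrite -[(f - g) k]/(f k - g k).
by have [->|] := eqVneq (f k) 0; [rewrite sub0r oppr_eq0; right|left].
Qed.

HB.instance Definition _ := GRing.isZmodClosed.Build (int -> Lam) finsupp
  finsupp_zmod_closed.

End DirectSum.

Record dirsum (Lam : zmodType) := DirSum {
  dirsum_fun :> int -> Lam;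
  dirsumP : dirsum_fun \in @finsupp Lam }.

Section SemidirectProduct.
Variable Lam : zmodType.

HB.instance Definition _ := [isSub for @dirsum_fun Lam].
HB.instance Definition _ := [Choice of dirsum Lam by <:].
HB.instance Definition _ := [SubChoice_isSubZmodule of dirsum Lam by <:].

Lemma dirsum_shift_subproof (n : int) (f : dirsum Lam) :
  (fun k => f (k - n)) \in @finsupp Lam.
Proof.
apply/asboolP; have /asboolP ff := dirsumP f.
apply: sub_finite_set (finite_image (fun k => k + n) ff) => k /= fk.
by exists (k - n) => //; rewrite subrK.
Qed.

Definition dirsum_shift (n : int) (f : dirsum Lam) : dirsum Lam :=
  DirSum (dirsum_shift_subproof n f).

(* Lam is written additively, hence so is the pointwise product on dirsum Lam. *)
Definition semidirect : Type := (dirsum Lam * int)%type.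

HB.instance Definition _ := Choice.on semidirect.

Definition semidirect_one : semidirect := (0, 0).

Definition semidirect_mul (p q : semidirect) : semidirect :=
  (p.1 + dirsum_shift p.2 q.1, p.2 + q.2).

Definition semidirect_inv (p : semidirect) : semidirect :=
  (- dirsum_shift (- p.2) p.1, - p.2).

Lemma dirsum_shiftD n f g :
  dirsum_shift n (f + g) = dirsum_shift n f + dirsum_shift n g.
Proof. exact: val_inj. Qed.

Lemma dirsum_shiftN n f : dirsum_shift n (- f) = - dirsum_shift n f.
Proof. exact: val_inj. Qed.

Lemma dirsum_shiftA m n f :
  dirsum_shift m (dirsum_shift n f) = dirsum_shift (m + n) f.
Proof. by apply/val_inj/funext => k /=; rewrite opprD addrA. Qed.

Lemma dirsum_shift0 f : dirsum_shift 0 f = f.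
Proof. by apply/val_inj/funext => k /=; rewrite subr0. Qed.

Lemma semidirect_mulA : associative semidirect_mul.
Proof.
by move=> p q r; rewrite /semidirect_mul/= dirsum_shiftD dirsum_shiftA
  !addrA.
Qed.

Lemma semidirect_mul1 : left_id semidirect_one semidirect_mul.
Proof. by case=> f m; rewrite /semidirect_mul/= dirsum_shift0 !add0r. Qed.

Lemma semidirect_mulr1 : right_id semidirect_one semidirect_mul.
Proof.
case=> f m; rewrite /semidirect_mul/= addr0 (_ : dirsum_shift m 0 = 0) ?addr0//.
exact: val_inj.
Qed.

Lemma semidirect_mulV :
  left_inverse semidirect_one semidirect_inv semidirect_mul.
Proof. by case=> f m; rewrite /semidirect_mul/= !addNr. Qed.

Lemma semidirect_mulrV :
  right_inverse semidirect_one semidirect_inv semidirect_mul.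
Proof.
by case=> f m; rewrite /semidirect_mul/= dirsum_shiftN dirsum_shiftA !subrr
  dirsum_shift0 subrr.
Qed.

HB.instance Definition _ := isGroup.Build semidirect
  semidirect_mulA semidirect_mul1 semidirect_mulr1
  semidirect_mulV semidirect_mulrV.

End SemidirectProduct.

Section Setting.
Variables (R : realType) (Lam : zmodType).
Local Notation G := (semidirect Lam).
Local Notation A := (bop R G).

Definition Lgrp : set G := [set h | h.2 = 0].
Definition calA0 : set A := @cstar R G setT.
Definition calB0 : set A := @cstar R G Lgrp.

Definition uop : A := lambda R ((0, 1) : G).

Definition alpha (b : A) : A := uop * b * adjoint uop.

(* The inverse of the restriction of alpha to calB0. *)
Definition alpha_inv : A -> A := 'pinv_(fun=> 0) calB0 alpha.

Definition catalan (m : nat) : R[i] := (m.+1%:R)^-1 * 'C(m.*2, m)%:R.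

Definition Rtransform_term (kappa : seq A -> A) (x b : A) (n : nat) : A :=
  kappa (rcons (nseq n (x * b)) x).

Definition Rtransform (kappa : seq A -> A) (x b : A) : A :=
  limn (series (Rtransform_term kappa x b)).

Definition catalan_term (b : A) (m : nat) : A :=
  ((-1) ^+ m * catalan m) *:
    ((alpha b * b) ^+ m * alpha b + (alpha_inv b * b) ^+ m * alpha_inv b).

End Setting.

(* Main.v *)
Require Import Defs.
From mathcomp Require Import all_boot all_order all_algebra.
From mathcomp Require Import zify ring lra.
From mathcomp Require boolp.

Set Implicit Arguments.
Unset Strict Implicit.
Unset Printing Implicit Defensive.
Import Order.TTheory GRing.Theory Num.Theory.
Local Open Scope ring_scope.

(** The argument has a combinatorial half and an analytic half.

Expand a product of factors x b_i into words in u and u^-1 with coefficients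
in B0. The conditional expectation keeps the words whose exponents sum to zero
and kills the others ([moment_uletter]), so in each moment a word occurs with a
scalar coefficient that depends on its signs alone: the *-moment of a Haar
unitary. The cumulants inherit this shape ([cumulantE]): removing an interval
block of a partition puts the word of the block back in its place among the
remaining letters ([prod_absorb]), so the word as a whole is untouched and only
scalars multiply. Hence the coefficient of a word in the operator-valued
cumulant is the scalar free cumulant of the Haar unitary.

These scalars vanish unless the word is alternating of even length 2m, where
they are (-1)^(m-1) C_(m-1) ([ncsum_alt_weight], [signed_ballot_catalan]). To
see that such weights do sum to the moments over all non-crossing partitions,
follow the block of the least element. Its next element leaves a gap of sum
zero behind, so in terms of the walk with steps +1 and -1 spelled by the word,
the block consists of steps across one fixed edge, taken alternately up and
down. The sum over such blocks depends only on how often the walk crosses that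
edge, and solving the recursion in that number gives signed ballot numbers
([first_block_sumE]).

In the cumulant of (x b, ..., x b, x) only the two alternating words are left,
and they are the terms of the Catalan series ([cumulant_of_x]). Up to the zero
terms of the R-transform, both series have the same partial sums.

For the closed form put c = b alpha(b), so that the norm of 4 c is less than 1.
The sum T of (-1)^m C_m c^m satisfies T + c T^2 = 1 by Segner's recurrence
([catalan_eq]), whence (1 + 2 c T)^2 = 1 + 4 c and T (1 + (1 + 2 c T)) = 2. It
remains to identify 1 + 2 c T with the square root s supplied by the functional
calculus. Both have the same square and commute, so their difference d
satisfies d (1 + s) = - d (2 c T); the real part of the principal root is
nonnegative, so (1 + s)^-1 has norm at most 1, while 2 c T has norm less than
1, and d = 0 ([sqrt_calculus]). The case of alpha^-1 is the same. *)

(** * Sums over non-crossing partitions *)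

Section NonCrossing.
Variable n : nat.
Implicit Types (P Q : {set {set 'I_n}}) (S V W : {set 'I_n}) (i j k l a : 'I_n).

Definition ncpart P S := partition P S && noncrossing P.

(** The elementwise form in which the bijections below are checked. *)
Record ncpart_spec P S : Prop := NcpartSpec {
  ncp_neq0 : forall V, V \in P -> exists i, i \in V;
  ncp_sub : forall V i, V \in P -> i \in V -> i \in S;
  ncp_cover : forall i, i \in S -> exists2 V, V \in P & i \in V;
  ncp_uniq : forall V W i, V \in P -> W \in P -> i \in V -> i \in W -> V = W;
  ncp_nc : forall V W i j k l, V \in P -> W \in P ->
    i \in V -> j \in W -> k \in V -> l \in W ->
    (i < j)%N -> (j < k)%N -> (k < l)%N -> V = W }.

Lemma ncpartP P S : reflect (ncpart_spec P S) (ncpart P S).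
Proof.
apply: (iffP andP) => [[/and3P[/eqP <- /trivIsetP tI nP0] nc]|[N U C I X]].
  split=> [V VP|V i VP iV|i /bigcupP[V VP iV]|V W i VP WP iV iW|
    V W i j k l VP WP iV jW kV lW ij jk kl].
  - by apply/set0Pn; apply: contraNneq nP0 => <-.
  - by apply/bigcupP; exists V.
  - by exists V.
  - apply/eqP/negPn/negP => /(tI _ _ VP WP) /pred0P/(_ i).
    by rewrite /= iV iW.
  - apply/eqP/negPn/negP => VW.
    move/forall_inP/(_ _ VP)/forall_inP/(_ _ WP)/implyP/(_ VW)/negP: nc; apply.
    apply/exists_inP; exists i => //; apply/exists_inP; exists j => //.
    by apply/exists_inP; exists k => //; apply/exists_inP; exists l => //; apply/and3P.
split; first apply/and3P; first split.
- apply/eqP/setP => i; apply/bigcupP/idP => [[V VP iV]|/C[V]]; first exact: U iV.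
  by exists V.
- apply/trivIsetP => V W VP WP VW; apply/pred0P => i /=; apply/negP => /andP[iV iW].
  by rewrite (I V W i) ?eqxx in VW.
- by apply/negP => /N[i]; rewrite inE.
apply/forall_inP => V VP; apply/forall_inP => W WP; apply/implyP => VW; apply/negP.
move=> /exists_inP[i iV] /exists_inP[j jW] /exists_inP[k kV] /exists_inP[l lW].
by case/and3P=> ij jk kl; rewrite (X V W i j k l) ?eqxx in VW.
Qed.

(** This is what keeps the blocks of a partition of [S1] from crossing those of a
partition of [S2]. *)
Definition separated S1 S2 := forall i j k l, (i < j)%N -> (j < k)%N -> (k < l)%N ->
  ~ [/\ i \in S1, j \in S2, k \in S1 & l \in S2] /\
  ~ [/\ i \in S2, j \in S1, k \in S2 & l \in S1].

Lemma in_ssetI P S V : (V \in P ::&: S) = (V \in P) && (V \subset S).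
Proof. by rewrite !inE. Qed.

Lemma ncpart_restrict P S S1 : ncpart_spec P S -> S1 \subset S ->
  (forall V i, V \in P -> i \in V -> i \in S1 -> V \subset S1) ->
  ncpart_spec (P ::&: S1) S1.
Proof.
move=> [N U C I X] S1S cl; split.
- by move=> V; rewrite in_ssetI => /andP[VP _]; exact: N.
- by move=> V i; rewrite in_ssetI => /andP[_ /subsetP]; apply.
- move=> i iS1; have [V VP iV] := C i (subsetP S1S i iS1).
  by exists V; rewrite // in_ssetI VP (cl V i).
- by move=> V W i; rewrite !in_ssetI => /andP[+ _] /andP[+ _]; exact: I.
- by move=> V W i j k l; rewrite !in_ssetI => /andP[+ _] /andP[+ _]; exact: X.
Qed.

Lemma ncpart_union P1 P2 S1 S2 : [disjoint S1 & S2] -> separated S1 S2 ->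
  ncpart_spec P1 S1 -> ncpart_spec P2 S2 -> ncpart_spec (P1 :|: P2) (S1 :|: S2).
Proof.
move=> /pred0P dis sep [N1 U1 C1 I1 X1] [N2 U2 C2 I2 X2].
have {}dis i : i \in S1 -> i \in S2 -> False.
  by move=> i1 i2; move: (dis i); rewrite /= i1 i2.
split.
- by move=> V /setUP[]; [exact: N1|exact: N2].
- by move=> V i /setUP[VP|VP] iV; rewrite inE; [rewrite (U1 V)|rewrite (U2 V) ?orbT].
- move=> i /setUP[/C1|/C2] [V VP iV]; exists V => //; rewrite inE VP ?orbT//.
- move=> V W i /setUP[VP|VP] /setUP[WP|WP] iV iW; try by [exact: I1 iW|exact: I2 iW].
    by case: (dis i); [exact: U1 iV|exact: U2 iW].
  by case: (dis i); [exact: U1 iW|exact: U2 iV].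
- move=> V W i j k l /setUP[VP|VP] /setUP[WP|WP] iV jW kV lW ij jk kl;
    try by [exact: (X1 _ _ i j k l)|exact: (X2 _ _ i j k l)].
    have [+ _] := sep i j k l ij jk kl; case.
    by split; [exact: U1 iV|exact: U2 jW|exact: U1 kV|exact: U2 lW].
  have [_ +] := sep i j k l ij jk kl; case.
  by split; [exact: U2 iV|exact: U1 jW|exact: U2 kV|exact: U1 lW].
Qed.

Variable K : comPzRingType.
Implicit Types w : {set 'I_n} -> K.

(** For multiplicative weights this is the moment with free cumulants [w]. *)
Definition ncsum w S : K := \sum_(P | ncpart P S) \prod_(V in P) w V.

(** A non-crossing partition compatible with a separated splitting is the same as a
pair of non-crossing partitions. The predicate [C] carries along a condition on
the second one, which [ncsum_next] needs. *)
Lemma ncsum_split w S1 S2 (C : pred {set {set 'I_n}}) :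
  [disjoint S1 & S2] -> separated S1 S2 ->
  \sum_(P | [&& ncpart P (S1 :|: S2),
     [forall V in P, (V \subset S1) || (V \subset S2)] & C (P ::&: S2)])
     \prod_(V in P) w V
  = ncsum w S1 * \sum_(P | ncpart P S2 && C P) \prod_(V in P) w V.
Proof.
move=> dis sep; rewrite /ncsum big_distrlr /= pair_big_dep /=.
have disE i : i \in S1 -> i \in S2 -> False.
  by move=> i1 i2; move/pred0P: dis => /(_ i); rewrite /= i1 i2.
have restr P1 P2 : ncpart_spec P1 S1 -> ncpart_spec P2 S2 ->
  ((P1 :|: P2) ::&: S1 = P1) /\ ((P1 :|: P2) ::&: S2 = P2).
  move=> h1 h2; split; apply/setP => V; rewrite in_ssetI inE.
    apply/andP/idP => [[/orP[//|VP] /subsetP VS]|VP]; last first.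
      by rewrite VP; split=> //; apply/subsetP => i; exact: ncp_sub h1 _ _ VP.
    have [i iV] := ncp_neq0 h2 VP.
    by case: (disE i (VS _ iV) (ncp_sub h2 VP iV)).
  apply/andP/idP => [[/orP[VP|//] /subsetP VS]|VP]; last first.
    by rewrite VP orbT; split=> //; apply/subsetP => i; exact: ncp_sub h2 _ _ VP.
  have [i iV] := ncp_neq0 h1 VP.
  by case: (disE i (ncp_sub h1 VP iV) (VS _ iV)).
rewrite (reindex_onto (fun p => p.1 :|: p.2) (fun P => (P ::&: S1, P ::&: S2))) /=.
  apply: eq_big => [[P1 P2]|[P1 P2]] /=.
    apply/andP/and3P => [[/and3P[/ncpartP h /forall_inP VS c] /eqP[e1 e2]]|].
      have cl V i : V \in P1 :|: P2 -> i \in V -> i \in S1 -> V \subset S1.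
        move=> VP iV iS1; case/orP: (VS V VP) => // /subsetP V2.
        by case: (disE i iS1 (V2 _ iV)).
      have cl' V i : V \in P1 :|: P2 -> i \in V -> i \in S2 -> V \subset S2.
        move=> VP iV iS1; case/orP: (VS V VP) => // /subsetP V2.
        by case: (disE i (V2 _ iV) iS1).
      have := ncpart_restrict h (subsetUl _ _) cl.
      have := ncpart_restrict h (subsetUr _ _) cl'.
      rewrite e1 e2 => h2 h1; split; [exact/ncpartP|exact/ncpartP|].
      by rewrite -e2.
    move=> [/ncpartP h1 /ncpartP h2 c]; have [e1 e2] := restr _ _ h1 h2.
    rewrite e1 e2 eqxx; split=> //; apply/and3P; split=> //.
      by apply/ncpartP; exact: ncpart_union.
    apply/forall_inP => V /setUP[VP|VP]; apply/orP; [left|right]; apply/subsetP => i.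
      exact: ncp_sub h1 _ _ VP.
    exact: ncp_sub h2 _ _ VP.
  move=> /andP[/and3P[/ncpartP h _ _] /eqP[e1 e2]].
  rewrite -bigU /=; first by apply: eq_bigl => V; rewrite !inE.
  apply/pred0P => V /=; apply/negP => /andP[].
  rewrite -{1}e1 -{2}e2 !in_ssetI => /andP[VP /subsetP V1] /andP[_ /subsetP V2].
  by have [i iV] := ncp_neq0 h VP; case: (disE i (V1 _ iV) (V2 _ iV)).
move=> P /and3P[_ /forall_inP VS _]; apply/setP => V; rewrite inE !in_ssetI.
by case VP: (V \in P) => //=; rewrite VS.
Qed.

Definition addtop a j V := if j \in V then a |: V else V.

(** If [a] and [j] are neighbours in their block and nothing lies between them,
contracting [a] to [j] neither creates nor destroys a crossing. *)
Lemma ncsum_contract w S a j : j \in S -> (a < j)%N ->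
  (forall i, i \in S -> (j <= i)%N) ->
  \sum_(P | ncpart P (a |: S) && [exists V in P, (a \in V) && (j \in V)])
     \prod_(V in P) w V
  = ncsum (fun V => w (addtop a j V)) S.
Proof.
move=> jS aj minj.
have aS : a \notin S by apply/negP => /minj; rewrite leqNgt aj.
have gta i : i \in S -> (a < i)%N by move/minj; exact: leq_trans.
have a_j : (j == a) = false by apply/negP => /eqP ja; rewrite ja ltnn in aj.
have addK V : a \notin V -> addtop a j V :\ a = V.
  rewrite /addtop; case: ifP => _ aV; first by rewrite setU1K.
  by apply/setDidPl; rewrite disjoint_sym disjoints1.
rewrite /ncsum (reindex_onto (fun P => addtop a j @: P) (fun P => (fun V => V :\ a) @: P)) /=.
  apply: eq_big => [P|P].
    apply/andP/idP => [[/andP[/ncpartP h /exists_inP[V0 V0P /andP[aV0 jV0]]] /eqP eP]|].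
      have [N U C I X] := h.
      have only V : V \in addtop a j @: P -> a \in V -> V = V0.
        by move=> VP aV; apply: I aV aV0.
      have mP V : V \in P -> exists2 W, W \in addtop a j @: P & V = W :\ a.
        by rewrite -{1}eP => /imsetP[W WP ->]; exists W.
      have jV W : W \in addtop a j @: P -> a \in W -> j \in W.
        by move=> WP aW; rewrite (only W).
      apply/ncpartP; split.
      - move=> V /mP[W WP ->]; have [i iW] := N W WP.
        have [ia|ia] := eqVneq i a; last by exists i; rewrite !inE ia.
        by exists j; rewrite !inE a_j jV // -ia.
      - move=> V i /mP[W WP ->]; rewrite !inE => /andP[ia iW].
        by have := U W i WP iW; rewrite !inE (negbTE ia).
      - move=> i iS; have [|V VP iV] := C i; first by rewrite inE iS orbT.
        exists (V :\ a); first by rewrite -eP; apply: (imset_f (fun V => V :\ a)).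
        by rewrite !inE iV andbT; apply: contraNneq aS => <-.
      - move=> V V' i /mP[W WP ->] /mP[W' WP' ->]; rewrite !inE => /andP[_ iW] /andP[_ iW'].
        by rewrite (I _ _ i WP WP').
      - move=> V V' i k l m /mP[W WP ->] /mP[W' WP' ->]; rewrite !inE.
        move=> /andP[_ iW] /andP[_ kW] /andP[_ lW] /andP[_ mW] ik kl lm.
        by rewrite (X _ _ i k l m WP WP').
    move=> /ncpartP h; have [N U C I X] := h.
    have naV V : V \in P -> a \notin V by move=> VP; apply: contra aS; exact: U.
    have memT V i : V \in P -> i \in addtop a j V -> i != a -> i \in V.
      move=> VP; rewrite /addtop; case: ifP => // _; rewrite !inE.
      by move=> /orP[/eqP->|//]; rewrite eqxx.
    have memT' V i : i \in V -> i \in addtop a j V.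
      by rewrite /addtop; case: ifP => // _ iV; rewrite !inE iV orbT.
    have aT V : V \in P -> a \in addtop a j V -> j \in V.
      by move=> VP; rewrite /addtop; case: ifP => // _; rewrite (negbTE (naV _ VP)).
    have mS V i : V \in P -> i \in addtop a j V -> i \in a |: S.
      move=> VP iV; rewrite !inE; case: eqVneq => //= ia.
      by apply: U (VP) _; exact: memT.
    have [V0 V0P jV0] := C j jS.
    split.
      apply/andP; split; last first.
        apply/exists_inP; exists (addtop a j V0); first exact: imset_f.
        by rewrite /addtop jV0 !inE eqxx jV0 orbT.
      apply/ncpartP; split.
      - by move=> _ /imsetP[V VP ->]; have [i iV] := N V VP; exists i; exact: memT'.
      - by move=> _ i /imsetP[V VP ->]; exact: mS.
      - move=> i; rewrite !inE => /orP[/eqP ->|iS].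
          by exists (addtop a j V0); [exact: imset_f|rewrite /addtop jV0 !inE eqxx].
        have [V VP iV] := C i iS; exists (addtop a j V); [exact: imset_f|exact: memT'].
      - move=> _ _ i /imsetP[V VP ->] /imsetP[W WP ->] iV iW; congr addtop.
        have [ia|ia] := eqVneq i a.
          by subst i; apply: (I _ _ j VP WP); exact: aT.
        by apply: (I _ _ i VP WP); exact: memT.
      - move=> _ _ i k l m /imsetP[V VP ->] /imsetP[W WP ->] iV kW lV mW ik kl lm.
        congr addtop.
        have ne (x y : 'I_n) : (x < y)%N -> x \in a |: S -> y != a.
          move=> xy; apply: contraTneq => ya; rewrite !inE negb_or; subst y.
          rewrite (_ : x != a) ?andTb; last by apply: contraTneq xy => ->; rewrite ltnn.
          by apply: contraTN xy => /gta; rewrite -leqNgt; exact: ltnW.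
        have ka : k != a by apply: ne ik (mS _ _ VP iV).
        have la : l != a by apply: ne kl (mS _ _ WP kW).
        have ma : m != a by apply: ne lm (mS _ _ VP lV).
        have {}kW := memT _ _ WP kW ka; have {}lV := memT _ _ VP lV la.
        have {}mW := memT _ _ WP mW ma.
        have [ia|ia] := eqVneq i a; last exact: (X _ _ i k l m VP WP (memT _ _ VP iV ia)).
        (* a crossing that starts at a also starts at j, which is in the same block *)
        have jV : j \in V by subst i; exact: aT.
        have [kj|kj] := eqVneq k j; first by apply: (I _ _ j) => //; rewrite -kj.
        apply: (X _ _ j k l m VP WP) => //.
        by rewrite ltn_neqAle minj ?andbT ?(U _ _ WP kW)// eq_sym; exact: kj.
    apply/eqP/setP => V; apply/imsetP/idP => [[_ /imsetP[W WP ->] ->]|VP].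
      by rewrite addK ?naV.
    by exists (addtop a j V); [exact: imset_f|rewrite addK ?naV].
  move=> /andP[/andP[/ncpartP h /exists_inP[V0 V0P /andP[aV0 jV0]]] /eqP eP].
  rewrite big_imset//= => V W VP WP.
  have na V' : V' \in P -> a \notin V'.
    by rewrite -eP => /imsetP[V1 _ ->]; rewrite !inE eqxx.
  by move=> e; rewrite -(addK V) ?na// e addK ?na.
move=> P /andP[/ncpartP h /exists_inP[V0 V0P /andP[aV0 jV0]]].
have key V : V \in P -> addtop a j (V :\ a) = V.
  move=> VP; rewrite /addtop !inE a_j /=; case: ifP => jV.
    by rewrite (ncp_uniq h VP V0P jV jV0) setD1K.
  apply/setDidPl; rewrite disjoint_sym disjoints1; apply: contraFN jV => aV.
  by rewrite (ncp_uniq h VP V0P aV aV0).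
apply/setP => V; apply/imsetP/idP => [[_ /imsetP[W WP ->] ->]|VP].
  by rewrite key.
by exists (V :\ a); [exact: imset_f|rewrite key].
Qed.

Definition block_successor P a j :=
  (a < j)%N &&
  [exists V in P, [&& a \in V, j \in V & [forall i in V, (a < i)%N ==> (j <= i)%N]]].

Lemma ncsum0 w : ncsum w set0 = 1.
Proof.
rewrite /ncsum (big_pred1 set0) ?big_set0// => P; apply/ncpartP/eqP => [h|->].
  apply/setP => V; rewrite inE; apply/negP => VP.
  by have [i /(ncp_sub h VP)] := ncp_neq0 h VP; rewrite inE.
by split=> [V|V i|i|V W i|V W i j k l]; rewrite inE.
Qed.

Lemma ncsum1 w a : ncsum w [set a] = w [set a].
Proof.
rewrite /ncsum (big_pred1 [set [set a]]) ?big_set1// => P; apply/ncpartP/eqP => [h|->].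
  have sub1 V : V \in P -> V = [set a].
    move=> VP; have [i iV] := ncp_neq0 h VP; apply/setP => k; apply/idP/idP => [|/set1P->].
      exact: ncp_sub h _ _ VP.
    by have /set1P <- := ncp_sub h VP iV.
  have [V VP _] := ncp_cover h (set11 a).
  apply/setP => W; apply/idP/set1P => [/sub1//|->]; by rewrite -(sub1 V).
split.
- by move=> V /set1P->; exists a; rewrite set11.
- by move=> V i /set1P->.
- by move=> i /set1P->; exists [set a]; rewrite set11.
- by move=> V W i /set1P-> /set1P->.
- by move=> V W i j k l /set1P-> /set1P->.
Qed.

Lemma ncsum_single w S a : a \notin S -> (forall i, i \in S -> (a < i)%N) ->
  \sum_(P | ncpart P (a |: S) && ([set a] \in P)) \prod_(V in P) w V
    = w [set a] * ncsum w S.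
Proof.
move=> aS aminS.
have dis : [disjoint [set a] & S] by rewrite disjoints1.
have sep : separated [set a] S.
  move=> i j k l ij jk kl; split=> -[].
    by move=> /set1P ia _ /set1P ka; move: (ltn_trans ij jk); rewrite ia ka ltnn.
  by move=> /aminS ai /set1P ja _; rewrite ja ltnNge ltnW in ij.
have := @ncsum_split w [set a] S (fun=> true) dis sep.
under [X in _ = _ * X]eq_bigl do rewrite andbT.
rewrite ncsum1 => <-; apply: eq_bigl => P; rewrite andbT.
case nP : (ncpart P _) => //=; move/ncpartP: nP => h; apply/idP/forall_inP.
  move=> aP V VP; have [->|Va] := eqVneq V [set a]; first by rewrite subxx.
  apply/orP; right; apply/subsetP => i iV; have := ncp_sub h VP iV.
  rewrite !inE; case: eqVneq => // ia _; case/eqP: Va.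
  by apply: (ncp_uniq h VP aP iV); rewrite ia set11.
move=> VS; have [V VP aV] := ncp_cover h (setU11 a S).
case/orP: (VS V VP) => [V1|/subsetP/(_ a aV)]; last by rewrite (negbTE aS).
suff <- : V = [set a] by [].
by apply/eqP; rewrite eqEsubset V1 sub1set.
Qed.

(** A block that meets the gap between [a] and its successor [j] stays inside the
gap, since otherwise it would cross the block of [a] and [j]. So the gap splits
off, and in the remainder [a] can be contracted to [j]. *)
Lemma ncsum_next w S a j : a \notin S -> (forall i, i \in S -> (a < i)%N) -> j \in S ->
  \sum_(P | ncpart P (a |: S) && block_successor P a j) \prod_(V in P) w V
    = ncsum w [set i in S | (i < j)%N]
      * ncsum (fun V => w (addtop a j V)) [set i in S | (j <= i)%N].
Proof.
move=> aS aminS jS; set S1 := [set i in S | _]; set S2 := [set i in S | _].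
have aj := aminS j jS.
have S1P i : i \in S1 = (i \in S) && (i < j)%N by rewrite inE.
have S2P i : i \in S2 = (i \in S) && (j <= i)%N by rewrite inE.
have jS2 : j \in S2 by rewrite S2P jS leqnn.
rewrite -(@ncsum_contract w S2 a j) //; last by move=> i; rewrite S2P => /andP[].
have dis : [disjoint S1 & a |: S2].
  apply/pred0P => i /=; apply/negP => /andP[]; rewrite S1P !inE => /andP[iS ij].
  by rewrite leqNgt ij andbF orbF => /eqP ia; rewrite -ia iS in aS.
have sep : separated S1 (a |: S2).
  move=> i k l m ik kl lm; split=> -[]; rewrite S1P !inE.
    move=> /andP[/aminS ai _] /orP[/eqP ka|/andP[_ jk] /andP[_ lj] _].
      by rewrite ka ltnNge ltnW in ik.
    by rewrite ltnNge (leq_trans jk)// ltnW in lj.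
  move=> _ /andP[kS kj] /orP[/eqP la|/andP[_ jl]].
    by have := aminS k kS; rewrite -la ltnNge ltnW.
  move=> /andP[_ mj]; have := leq_ltn_trans jl lm.
  by rewrite ltnNge ltnW.
rewrite -(@ncsum_split w S1 (a |: S2) (fun P => [exists V in P, (a \in V) && (j \in V)]) dis sep).
have -> : S1 :|: (a |: S2) = a |: S.
  apply/setP => i; rewrite !inE; case: eqVneq => //= _; first by rewrite orbT.
  by case: (i \in S) => //=; case: ltnP.
apply: eq_bigl => P; case nP : (ncpart P _) => //=; move/ncpartP: nP => h.
apply/idP/andP => [/andP[_ /exists_inP[V VP /and3P[aV jV /forall_inP nx]]]|
  [/forall_inP VS /exists_inP[V]]].
  have V2 : V \subset a |: S2.
    apply/subsetP => i iV; have := ncp_sub h VP iV; rewrite !inE.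
    by case: eqVneq => //= ia iS; rewrite iS (implyP (nx i iV)) ?aminS.
  split; last first.
    by apply/exists_inP; exists V; rewrite ?in_ssetI ?VP ?aV ?jV.
  apply/forall_inP => W WP; have [->|WV] := eqVneq W V; first by rewrite V2 orbT.
  have naW : a \notin W by apply: contraNN WV => aW; rewrite (ncp_uniq h WP VP aW aV).
  have njW : j \notin W by apply: contraNN WV => jW; rewrite (ncp_uniq h WP VP jW jV).
  have WS i : i \in W -> i \in S.
    move=> iW; have := ncp_sub h WP iW; rewrite !inE; case: eqVneq => // ia.
    by rewrite -ia iW in naW.
  have [/existsP[i /andP[iW ij]]|/existsPn no] := boolP [exists i, (i \in W) && (i < j)%N].
    apply/orP; left; apply/subsetP => k kW; rewrite S1P WS//=.
    rewrite ltnNge; apply/negP => jk.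
    have {}jk : (j < k)%N by rewrite ltn_neqAle jk andbT; apply: contraNneq njW => /val_inj ->.
    case/eqP: WV; rewrite -(ncp_nc h (i:=a) (j:=i) (k:=j) (l:=k) VP WP) //.
    exact: aminS (WS _ iW).
  apply/orP; right; apply/subsetP => k kW; rewrite !inE WS//=.
  by have := no k; rewrite kW /= -leqNgt => ->; rewrite orbT.
rewrite in_ssetI => /andP[VP V2] /andP[aV jV]; rewrite /block_successor aj /=.
apply/exists_inP; exists V => //.
rewrite aV jV; apply/forall_inP => i iV; apply/implyP => ai.
move/subsetP/(_ _ iV): V2; rewrite !inE => /orP[/eqP ia|/andP[]//].
by rewrite ia ltnn in ai.
Qed.

(** Sort the partitions by the successor of [a] in its block; the first term stands
for those in which [a] is a block of its own. Contracting [a] changes only the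
weight of one block, so each further term is a product of two sums of the same
kind. *)
Lemma ncsum_rec w S a : a \notin S -> (forall i, i \in S -> (a < i)%N) ->
  ncsum w (a |: S) = w [set a] * ncsum w S +
    \sum_(j in S) ncsum w [set i in S | (i < j)%N]
      * ncsum (fun V => w (addtop a j V)) [set i in S | (j <= i)%N].
Proof.
move=> aS aminS; rewrite {1}/ncsum (bigID (fun P => [set a] \in P)) /= ncsum_single//.
congr (_ + _); pose p P := odflt a [pick j | block_successor P a j].
have nextU P i k : ncpart P (a |: S) -> block_successor P a i -> block_successor P a k -> i = k.
  move=> /ncpartP h /andP[ai /exists_inP[V VP /and3P[aV iV nV]]].
  move=> /andP[ak /exists_inP[W WP /and3P[aW kW nW]]].
  have VW := ncp_uniq h VP WP aV aW; subst W; apply/val_inj/eqP.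
  by rewrite /= eqn_leq (implyP (forall_inP nV k kW))// (implyP (forall_inP nW i iV)).
have nextS P i : ncpart P (a |: S) -> block_successor P a i -> i \in S.
  move=> /ncpartP h /andP[ai /exists_inP[V VP /and3P[aV iV _]]].
  by have := ncp_sub h VP iV; rewrite !inE => /orP[/eqP ia|//]; rewrite ia ltnn in ai.
have nextE P : ncpart P (a |: S) -> [set a] \notin P -> exists j, block_successor P a j.
  move=> /ncpartP h aP; have [V VP aV] := ncp_cover h (setU11 a S).
  have [k kV ka] : exists2 k, k \in V & k != a.
    apply/exists_inP; apply: contraR aP => /exists_inPn no.
    suff <- : V = [set a] by [].
    apply/setP => i; rewrite inE; apply/idP/eqP => [/no|->//]; by rewrite negbK => /eqP.
  have VS i : i \in V -> i != a -> i \in S.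
    by move=> iV ia; have := ncp_sub h VP iV; rewrite !inE (negbTE ia).
  have ex : (k \in V) && (k != a) by rewrite kV.
  have [j /andP[jV ja] jm] := @arg_minnP _ k (fun i => (i \in V) && (i != a)) (@nat_of_ord n) ex.
  exists j; rewrite /block_successor aminS ?VS//=.
  apply/exists_inP; exists V; rewrite // aV jV; apply/forall_inP => i iV.
  by apply/implyP => ai; apply: jm; rewrite iV; apply: contraTneq ai => ->; rewrite ltnn.
rewrite (partition_big p (mem S)) /=; last first.
  move=> P /andP[h aP]; rewrite /p; have [j hj] := nextE P h aP.
  by case: pickP => [i|/(_ j)]; [exact: nextS|rewrite hj].
apply: eq_bigr => j jS; rewrite -(ncsum_next w aS aminS jS).
apply: eq_bigl => P; rewrite -andbA; case h: (ncpart P _) => //=.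
apply/andP/idP => [[aP /eqP pj]|nj].
  move: pj; rewrite /p; have [i hi] := nextE P h aP.
  by case: pickP => [k hk /= <-//|/(_ i)]; rewrite hi.
split; last first.
  by rewrite /p; case: pickP => [k hk|/(_ j)]; [rewrite (nextU P k j)|rewrite nj].
apply/negP => aP; have /ncpartP h' := h; have /andP[aj /exists_inP[V VP /and3P[aV jV _]]] := nj.
have Va := ncp_uniq h' VP aP aV (set11 a).
by move: jV aj; rewrite Va => /set1P ->; rewrite ltnn.
Qed.

End NonCrossing.

(** * Walks and signed ballot numbers *)

(** The value of [first_block_sum] for a walk that still crosses the edge [N] times
(see [first_block_sumE]). Solved for the first term on its right, the
recursion [signed_ballot_rec] determines level [k.+1] from level [k]; level 0 is prescribed by the
moments of the Haar unitary. *)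
Fixpoint signed_ballot (k N : nat) : int :=
  if k is k'.+1 then signed_ballot k' N.+1 - (if N is N'.+1 then signed_ballot k' N' else 0)
  else (odd N)%:R.

Lemma signed_ballot_even k N : ~~ odd (k + N) -> signed_ballot k N = 0.
Proof.
elim: k N => [N /negbTE /= ->//|k IH [|N]] /=.
  by rewrite addn0 => o; rewrite IH ?subr0// addn1.
by rewrite !addnS /= negbK => o; rewrite !IH ?subrr//= ?addnS/= ?o ?negbK.
Qed.

Lemma signed_ballot_rec k N :
  signed_ballot k N.+1 = signed_ballot k.+1 N + (if N is N'.+1 then signed_ballot k N' else 0).
Proof. by rewrite /= subrK. Qed.

(** The letter [e] serves as orientation, so that the first letter of a block is
always a step up. *)
Definition step (e c : bool) : int := if c == e then 1 else -1.
Definition height (e : bool) (s : seq bool) : int := \sum_(c <- s) step e c.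

(** The edge in question joins the heights -1 and 0. *)
Fixpoint crossings (e : bool) (h : int) (s : seq bool) : nat :=
  if s is c :: s' then
    ((h == 0) && (c != e)) + ((h == -1) && (c == e)) + crossings e (h + step e c) s'
  else 0%N.

(** The recursion [ncsum_rec] read along a word. Here [e] is the letter last put into
the block of the least element, [k] counts the letters put there before [e], and
[h] is the height gained since. A letter can be the next of the block if it
differs from [e] and the gap before it sums to zero; the last clause closes the
block, with the letters after [e] as the last gap. *)
Fixpoint first_block_sum (k : nat) (e : bool) (h : int) (s : seq bool) : int :=
  if s is c :: s' then
    (if (h == 0) && (c != e) then first_block_sum k.+1 c 0 s' else 0)
    + first_block_sum k e (h + step e c) s'
  else signed_ballot k 0 * (h == 0)%:R.

Lemma step_neg e c : step (~~ e) c = - step e c.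
Proof. by case: e c => -[]. Qed.

Lemma height_neg e s : height (~~ e) s = - height e s.
Proof. by rewrite /height -sumrN; apply: eq_bigr => c _; rewrite step_neg. Qed.

Lemma height_cons e c s : height e (c :: s) = step e c + height e s.
Proof. by rewrite /height big_cons. Qed.

(** Changing the orientation reflects the heights about -1/2 and so maps the edge
to itself. *)
Lemma crossings_neg e h s : crossings (~~ e) h s = crossings e (-1 - h) s.
Proof.
elim: s h => //= c s IH h; rewrite IH step_neg.
have -> : -1 - (h - step e c) = -1 - h + step e c by ring.
congr (_ + _)%N; rewrite addnC; congr (_ + _)%N.
  by congr (nat_of_bool (_ && _)); [lia|case: c e {IH} => -[]].
by congr (nat_of_bool (_ && _)); [lia|case: c e {IH} => -[]].
Qed.

Lemma odd_crossings e h s :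
  odd (crossings e h s) = (0 <= h) (+) (0 <= h + height e s).
Proof.
elim: s h => [h|c s IH h]; first by rewrite /= /height big_nil addr0 addbb.
rewrite /= !oddD IH height_cons addrA !oddb.
have [E|E] : c == e /\ step e c = 1 \/ (c == e) = false /\ step e c = -1.
  by rewrite /step; case: eqP; [left|right].
  case: E => -> ->; rewrite andbF andbT /=; lia.
case: E => -> ->; rewrite andbF andbT /=; lia.
Qed.

(** The total height that allows the block to be completed. If [k] is odd then [e] is
at an even place of the block, which may end there; if [k] is even, one more
letter opposite to [e] has to follow. *)
Definition closes k (h : int) := if odd k then h == 0 else h == -1.

(** Every letter chosen for the block is a step across the edge, and the choices
alternate between down and up. When the walk is below the edge its next crossing
goes up and cannot be chosen, which accounts for the shift by one in that case. *)
Lemma first_block_sumE k e h s :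
  first_block_sum k e h s =
  if closes k (h + height e s) then
    if 0 <= h then signed_ballot k (crossings e h s)
    else if crossings e h s is N.+1 then signed_ballot k N else 0
  else 0.
Proof.
elim: s k e h => [|c s IH] k e h.
  rewrite /= /height big_nil addr0 /closes; case ok: (odd k).
    by case: eqVneq => [->|h0]; rewrite ?lexx ?mulr1 ?mulr0.
  by rewrite signed_ballot_even ?addn0 ?ok// mul0r; case: eqP => [->|].
rewrite /= height_cons addrA.
have [->|ce] := eqVneq c e.
  rewrite andbF add0r /step eqxx IH; case: ifP => // _; rewrite andbT.
  have [h0|h0] := leP 0 h.
    by rewrite addr_ge0// (_ : (h == -1) = false)//; lia.
  have [->|h1] := eqVneq h (-1); first by [].
  by rewrite (_ : (0 <= h + 1) = false)//; lia.
have {ce}-> : c = ~~ e by case: c e ce => -[].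
have Ne : (~~ e == e) = false by case: e.
rewrite /step Ne andbF andbT addn0.
have [->|h0] := eqVneq h 0.
  rewrite !add0r !IH lexx add0r height_neg crossings_neg subr0 add1n.
  have -> : closes k.+1 (- height e s) = closes k (-1 + height e s).
    by rewrite /closes /=; case: (odd k) => /=; lia.
  by case: ifP => _; rewrite /= ?addr0// -signed_ballot_rec.
rewrite add0r IH add0n; case: ifP => // _.
have [h1|h1] := leP 0 h; first by rewrite (_ : (0 <= h - 1) = true)//; lia.
by rewrite (_ : (0 <= h - 1) = false)//; lia.
Qed.

(** The walk ends at height -1 only after an odd number of crossings, and for those
level 0 of [signed_ballot] equals 1. *)
Lemma first_block_sum0 e s : first_block_sum 0 e 0 s = (height e (e :: s) == 0)%:R.
Proof.
rewrite first_block_sumE /= add0r /closes /= height_cons /step eqxx odd_crossings add0r.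
have -> : (1 + height e s == 0) = (height e s == -1) by lia.
by case: eqP => [->|].
Qed.

(** The reflection principle: both sides obey Pascal's rule, and at the boundary
[N = 0] the two binomials that would have to cancel are equal by symmetry. *)
Lemma signed_ballotE n h N : (N + n = h.*2)%N ->
  signed_ballot n.+1 N = (-1) ^+ h * ('C(n, h)%:Z - 'C(n, h.+1)%:Z).
Proof.
elim: n h N => [|n IH] h N Nh.
  have {Nh}-> : N = h.*2 by rewrite -Nh addn0.
  by case: h => [|h] //; rewrite doubleS /= negbK subrr mulr0.
rewrite -[LHS]/(signed_ballot n.+1 N.+1 - (if N is N'.+1 then signed_ballot n.+1 N' else 0)).
rewrite (IH h); last by lia.
case: h => [|h] in Nh *; first by rewrite addnS in Nh.
case: N => [|N] in Nh *; last first.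
  by rewrite (IH h); [rewrite !binS !PoszD exprS; ring|lia].
suff e : 'C(n, h) = 'C(n, h.+1) by rewrite !binS !PoszD e; ring.
by rewrite -bin_sub; [congr 'C(_, _); lia|lia].
Qed.

Lemma signed_ballot_catalan q : signed_ballot q.*2.+1 0 * q.+1%:Z = (-1) ^+ q * 'C(q.*2, q)%:Z.
Proof.
rewrite (@signed_ballotE _ q) ?add0n// -mulrA; congr (_ * _).
have := mul_bin_left q.*2 q; rewrite -addnn addnK => e.
by rewrite mulrBl -!PoszM mulnC [in X in _ - X]mulnC e; lia.
Qed.

(** * The free cumulants of a Haar unitary *)

Section Blocks.
Variables (n : nat) (T : {set 'I_n}).
Implicit Types (S V : {set 'I_n}) (a i j : 'I_n).

Definition word S : seq bool := [seq i \in T | i <- enum S].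

Definition alternating (s : seq bool) := sorted (fun x y => x != y) s.

(** For [k = 0] this is the free cumulant of a Haar unitary at the word [s]; in general
[k] elements have already been contracted into the block. The predecessor is there
because [signed_ballot] does not count the last letter of the block. *)
Definition alt_weight k (s : seq bool) : int :=
  if alternating s then signed_ballot (k + size s).-1 0 else 0.

Lemma enum_sorted S : sorted ltn [seq val i | i <- enum S].
Proof.
have -> : enum S = [seq i <- enum 'I_n | i \in S] by rewrite enumT.
apply: (subseq_sorted ltn_trans (map_subseq _ (filter_subseq _ _))).
by rewrite val_enum_ord iota_ltn_sorted.
Qed.

Lemma enum_min S a : a \notin S -> (forall i, i \in S -> (a < i)%N) ->
  enum (a |: S) = a :: enum S.
Proof.
move=> aS aminS; apply: (inj_map val_inj).
apply: (irr_sorted_eq ltn_trans ltnn) => [||k]; first exact: enum_sorted.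
  rewrite /= (path_sortedE ltn_trans) enum_sorted andbT.
  by apply/allP => _ /mapP[i iS ->]; apply: aminS; rewrite mem_enum in iS.
by apply/mapP/mapP => -[i iS ->]; exists i; rewrite // !(mem_enum, inE) in iS *.
Qed.

Lemma enum_set_filter S (p : pred 'I_n) : enum [set i in S | p i] = [seq i <- enum S | p i].
Proof.
rewrite /enum_mem -filter_predI; apply: eq_filter => i /=; by rewrite inE andbC.
Qed.

Lemma first_block_sum_split k e h (l : seq 'I_n) : sorted ltn [seq val i | i <- l] ->
  first_block_sum k e h [seq i \in T | i <- l] =
    signed_ballot k 0 * (h + height e [seq i \in T | i <- l] == 0)%:R +
    \sum_(j <- l)
      (if (h + height e [seq i \in T | i <- [seq i : 'I_n <- l | (i < j)%N]] == 0)
          && ((j \in T) != e)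
       then first_block_sum k.+1 (j \in T) 0
              [seq i \in T | i <- [seq i : 'I_n <- l | (j < i)%N]]
       else 0).
Proof.
elim: l h => [|i l IH] h /=; first by rewrite /height !big_nil !addr0.
rewrite (path_sortedE ltn_trans) => /andP[/allP il sl].
have il' j : j \in l -> (i < j)%N by move=> jl; apply: il; exact: map_f.
rewrite IH// big_cons ltnn height_cons (addrA h) addrCA; congr (_ + _).
congr (_ + _).
  rewrite (eq_in_filter (a2 := pred0)) ?filter_pred0; last first.
    by move=> j jl; rewrite /= ltnNge ltnW ?il'.
  rewrite /height big_nil addr0.
  by rewrite (eq_in_filter (a2 := predT)) ?filter_predT.
rewrite !big_seq; apply: eq_bigr => j jl; rewrite il' //= height_cons (addrA h).
by rewrite ltnNge ltnW ?il'.
Qed.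

Lemma ncsum_ext (w w' : {set 'I_n} -> int) S :
  (forall V, V \subset S -> w V = w' V) -> ncsum w S = ncsum w' S.
Proof.
move=> ww; apply: eq_bigr => P /ncpartP h; apply: eq_bigr => V VP.
by apply: ww; apply/subsetP => i; exact: ncp_sub h _ _ VP.
Qed.

Lemma ncsum_eq0 (w : {set 'I_n} -> int) S j : j \in S ->
  (forall V, V \subset S -> j \in V -> w V = 0) -> ncsum w S = 0.
Proof.
move=> jS w0; apply: big1 => P /ncpartP h; have [V VP jV] := ncp_cover h jS.
rewrite (bigD1 V)//= w0 ?mul0r//.
by apply/subsetP => i; exact: ncp_sub h _ _ VP.
Qed.

Let wt k a V := alt_weight (if a \in V then k else 0) (word V).

(** The weights [alt_weight 0] are the free cumulants of the moments of a Haar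
unitary. By induction on the set, the gaps in [ncsum_rec] contribute their
moments, and the remainder is a sum with one more element in the first block; so
the recursion is the one that defines [first_block_sum]. *)
Lemma ncsum_alt_weight S :
  ncsum (fun V => alt_weight 0 (word V)) S = (height true (word S) == 0)%:R.
Proof.
suff H m : forall S', (#|S'| < m)%N ->
   ncsum (fun V => alt_weight 0 (word V)) S' = (height true (word S') == 0)%:R /\
   forall a k, a \notin S' -> (forall i, i \in S' -> (a < i)%N) ->
     ncsum (wt k a) (a |: S') = first_block_sum k (a \in T) 0 (word S').
  exact: (H _ S (leqnn _)).1.
elim: m => // m IH {}S Sm.
have word_min S' a : a \notin S' -> (forall i, i \in S' -> (a < i)%N) ->
  word (a |: S') = (a \in T) :: word S' by move=> aS am; rewrite /word enum_min.
have first : ncsum (fun V => alt_weight 0 (word V)) S = (height true (word S) == 0)%:R.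
  have [->|[i iS]] := set_0Vmem S.
    by rewrite ncsum0 /word enum_set0 /height big_nil.
  have [a aS amin] := @arg_minnP _ i (mem S) (@nat_of_ord n) iS.
  rewrite /= in aS amin; have aSa : a \notin S :\ a by rewrite !inE eqxx.
  have am k : k \in S :\ a -> (a < k)%N.
    by rewrite !inE => /andP[ka kS]; rewrite ltn_neqAle amin// andbT eq_sym.
  have Sam : (#|S :\ a| < m)%N by move: Sm; rewrite (cardsD1 a S) aS.
  have [_ /(_ a 0%N aSa am)] := IH _ Sam.
  rewrite setD1K// first_block_sum0 -word_min// setD1K// => e.
  have -> : (height true (word S) == 0) = (height (a \in T) (word S) == 0).
    by case: (a \in T); rewrite // -[false]/(~~ true) height_neg oppr_eq0.
  by rewrite -e; apply: ncsum_ext => V _; rewrite /wt if_same.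
split=> // a k aS am; rewrite ncsum_rec//.
have wtS S' : S' \subset S -> ncsum (wt k a) S' = ncsum (fun V => alt_weight 0 (word V)) S'.
  move=> /subsetP S'S; apply: ncsum_ext => V /subsetP VS'; rewrite /wt.
  by case: ifP => // /VS' /S'S; rewrite (negbTE aS).
rewrite wtS// first {1}/wt set11 /word enum_set1 /alt_weight /= addn1 /=.
rewrite first_block_sum_split ?enum_sorted// add0r; congr (_ * _ + _).
  case: (a \in T) => //; rewrite -[false]/(~~ true) -/(word S) height_neg oppr_eq0//.
rewrite -big_enum /= !big_seq; apply: eq_bigr => j; rewrite mem_enum => jS.
rewrite wtS; last by apply/subsetP => i; rewrite inE => /andP[].
have aj := am j jS; set S2 := [set i in S | (j < i)%N].
have S2m : (#|S2| < m)%N.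
  rewrite -ltnS; apply: leq_trans Sm; rewrite ltnS (cardsD1 j S) jS.
  apply/subset_leq_card/subsetP => i; rewrite !inE => /andP[-> ji]; rewrite andbT.
  by apply: contraTneq ji => ->; rewrite ltnn.
have S1m : (#|[set i in S | (i < j)%N]| < m)%N.
  rewrite -ltnS; apply: leq_trans Sm; rewrite ltnS (cardsD1 j S) jS.
  apply/subset_leq_card/subsetP => i; rewrite !inE => /andP[-> ji]; rewrite andbT.
  by apply: contraTneq ji => ->; rewrite ltnn.
rewrite (IH _ S1m).1 add0r -!enum_set_filter -/S2 -/(word _) -/(word S2).
have -> : [set i in S | (j <= i)%N] = j |: S2.
  apply/setP => i; rewrite !inE leq_eqVlt (inj_eq (@ord_inj n)) eq_sym.
  by case: eqVneq => [->|//]; rewrite jS.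
have jS2 : j \notin S2 by rewrite inE ltnn andbF.
have jm i : i \in S2 -> (j < i)%N by rewrite inE => /andP[].
rewrite -((IH _ S2m).2 j k.+1 jS2 jm).
set s1 := word _; have -> : (height true s1 == 0) = (height (a \in T) s1 == 0).
  by case: (a \in T); rewrite // -[false]/(~~ true) height_neg oppr_eq0.
case: eqP => _; rewrite ?mul0r//= mul1r.
have addw V : V \subset j |: S2 -> j \in V ->
    alt_weight k (word (a |: V)) = if (j \in T) != (a \in T) then alt_weight k.+1 (word V) else 0.
  move=> /subsetP VS jV.
  have VSS i : i \in V -> i \in S by move=> /VS; rewrite !inE => /orP[/eqP->//|/andP[]].
  have aV : a \notin V by apply: contra aS; exact: VSS.
  rewrite word_min//; last by move=> i /VSS; exact: am.
  have -> : word V = (j \in T) :: word (V :\ j).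
    rewrite -word_min ?setD1K//; first by rewrite !inE eqxx.
    by move=> i; rewrite !inE => /andP[ij /VS]; rewrite !inE (negbTE ij) => /andP[].
  by rewrite /alt_weight /= !addnS /= eq_sym; case: eqP.
have wtj V : V \subset j |: S2 -> j \notin V -> wt k a (addtop a j V) = alt_weight 0 (word V).
  move=> /subsetP VS jV; rewrite /addtop (negbTE jV) /wt ifN//.
  by apply: contra aS => /VS; rewrite !inE => /orP[/eqP->//|/andP[]].
case: ifP => ja.
  apply: ncsum_ext => V VS; have [jV|jV] := boolP (j \in V).
    by rewrite /addtop jV /wt setU11 jV addw// ja.
  by rewrite wtj// /wt (negbTE jV).
rewrite (ncsum_eq0 (j := j)) ?setU11// => V VS jV.
by rewrite /addtop jV /wt setU11 addw// ja.
Qed.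

End Blocks.

(** * Operator-valued cumulants with scalar coefficients *)

Lemma enum_setU n (S1 S2 : {set 'I_n}) :
  (forall i j, i \in S1 -> j \in S2 -> (i < j)%N) -> enum (S1 :|: S2) = enum S1 ++ enum S2.
Proof.
move=> lt12; apply: (inj_map val_inj).
apply: (irr_sorted_eq ltn_trans ltnn) => [||k]; first exact: enum_sorted.
  rewrite map_cat (sorted_pairwise ltn_trans) pairwise_cat.
  rewrite -!(sorted_pairwise ltn_trans) !enum_sorted !andbT.
  apply/allrelP => _ _ /mapP[i iS ->] /mapP[j jS ->].
  by rewrite !mem_enum in iS jS; exact: lt12.
by apply/mapP/mapP => -[i iS ->]; exists i; rewrite // !(mem_cat, mem_enum, inE) in iS *.
Qed.

(** A block [W] with the smallest hull is an interval: a block that meets the inside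
of [W] cannot cross [W], so it lies between two elements of [W] and has a smaller
hull. *)
Lemma ncpart_interval n (P : {set {set 'I_n}}) S V0 : ncpart_spec P S -> V0 \in P ->
  exists2 W, W \in P & interval_block P W.
Proof.
move=> h V0P.
pose hull (V : {set 'I_n}) :=
  [set j : 'I_n | [exists i in V, (i <= j)%N] && [exists k in V, (j <= k)%N]].
have [W WP Wmin] := @arg_minnP _ V0 (mem P) (fun V => #|hull V|) V0P.
exists W; first exact: WP.
rewrite /interval_block; apply/andP; split; first exact: WP.
apply/forall_inP => i iW; apply/forall_inP => k kW; apply/forall_inP => j.
move=> /bigcupP[V VP jV]; apply/implyP => /andP[ij jk].
apply/negPn/negP => jW.
have VW : V = W -> False by move=> VW; rewrite VW (negbTE jW) in jV.
have ne l x : l \in V -> x \in W -> l != x.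
  move=> lV xW; apply/eqP => lx; subst x.
  exact: VW (ncp_uniq h VP WP lV xW).
have Vin l : l \in V -> (i < l < k)%N.
  move=> lV; apply/andP; split; rewrite ltnNge; apply/negP => le.
    have {}le : (l < i)%N by rewrite ltn_neqAle le andbT (ne l i).
    exact: VW (ncp_nc h VP WP lV iW jV kW le ij jk).
  have {}le : (k < l)%N by rewrite ltn_neqAle le andbT eq_sym (ne l k).
  exact: VW (esym (ncp_nc h WP VP iW jV kW lV ij jk le)).
have := Wmin V VP; rewrite leqNgt => /negP; apply; apply: proper_card.
apply/properP; split; last first.
  exists i; rewrite inE.
    by apply/andP; split; apply/exists_inP; exists i.
  apply/negP => /andP[/exists_inP[l lV li] _].
  by have /andP[] := Vin l lV; rewrite ltnNge li.
apply/subsetP => x; rewrite !inE => /andP[/exists_inP[l lV lx] /exists_inP[r rV xr]].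
have /andP[il _] := Vin l lV; have /andP[_ rk] := Vin r rV.
by apply/andP; split; apply/exists_inP; [exists i|exists k] => //; lia.
Qed.

Lemma ncpartD1 n (P : {set {set 'I_n}}) S W : ncpart_spec P S -> W \in P ->
  ncpart_spec (P :\ W) (S :\: W).
Proof.
move=> h WP; have [N U C I X] := h; split.
- by move=> V /setD1P[_ /N].
- move=> V i /setD1P[VW VP] iV; rewrite inE (U V)// andbT.
  by apply: contraNN VW => iW; rewrite (I V W i).
- move=> i; rewrite inE => /andP[iW iS]; have [V VP iV] := C i iS.
  by exists V; rewrite // !inE VP andbT; apply: contraNneq iW => <-.
- by move=> V V' i /setD1P[_ +] /setD1P[_ +]; exact: I.
- by move=> V V' i j k l /setD1P[_ +] /setD1P[_ +]; exact: X.
Qed.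

Section Absorb.
Variables (A : pzRingType) (n : nat) (P : {set {set 'I_n}}) (W : {set 'I_n}).
Hypothesis W0 : W != set0.
Hypothesis Wint : interval_block P W.
Let S' := cover P :\: W.
Hypothesis S'0 : S' != set0.

Definition below : {set 'I_n} := [set i in S' | [forall w in W, (i < w)%N]].
Definition above : {set 'I_n} := [set i in S' | [forall w in W, (w < i)%N]].

Lemma below_lt i w : i \in below -> w \in W -> (i < w)%N.
Proof. by rewrite inE => /andP[_ /forall_inP]; apply. Qed.
Lemma above_gt i w : i \in above -> w \in W -> (w < i)%N.
Proof. by rewrite inE => /andP[_ /forall_inP]; apply. Qed.
Lemma below_above i j : i \in below -> j \in above -> (i < j)%N.
Proof.
have /set0Pn[w wW] := W0 => iB jA.
exact: ltn_trans (below_lt iB wW) (above_gt jA wW).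
Qed.

Lemma below_aboveE : S' = below :|: above.
Proof.
apply/setP => i; rewrite !inE; case iS: (i \in S'); rewrite // -/S'; last first.
  by move: iS; rewrite inE => ->.
move: iS; rewrite inE => /andP[iW iS]; rewrite iS iW /=; apply/esym.
have [|/forall_inPn[w wW wi]] := boolP [forall w in W, (i < w)%N]; first by [].
apply/orP; right; apply/forall_inP => v vW; rewrite ltnNge; apply/negP => iv.
have ne x : x \in W -> (x == i :> nat) = false.
  by move=> xW; apply: contraNF iW => /eqP/val_inj <-.
case/andP: Wint => _ /forall_inP/(_ w wW)/forall_inP/(_ v vW)/forall_inP/(_ i iS)/implyP.
rewrite (negbTE iW) => /(_ _)/notF; apply; have := ne w wW; have := ne v vW; lia.
Qed.

Lemma cover_enum : W \subset cover P ->
  enum (cover P) = enum below ++ enum W ++ enum above.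
Proof.
move=> WP; rewrite -enum_setU; last by move=> i j iW jA; exact: above_gt.
rewrite -enum_setU; last first.
  by move=> i j iB /setUP[]; [exact: below_lt|exact: below_above].
apply: (congr1 (fun X : {set 'I_n} => enum X)); rewrite setUCA -below_aboveE /S'.
by rewrite -[in LHS](setID (cover P) W) (setIidPr WP).
Qed.

(** Whichever neighbour absorbs [c], in the ordered product [c] stands at the place of
the removed block. *)
Lemma prod_absorb (c : A) (a : 'I_n -> A) :
  \prod_(i <- enum S') absorb P W c a i =
  (\prod_(i <- enum below) a i) * c * \prod_(i <- enum above) a i.
Proof.
have [w wW] := set0Pn _ W0.
rewrite below_aboveE enum_setU; last exact: below_above.
rewrite big_cat /=.
have inS i : i \in below \/ i \in above -> i \in S' by rewrite below_aboveE in_setU => -[]->; rewrite ?orbT.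
have inA i (iA : i \in above) : i \in S' by apply: inS; right.
have inB i (iB : i \in below) : i \in S' by apply: inS; left.
have ltW i : i \in S' -> [forall w in W, (i < w)%N] = (i \in below) by move=> iS; rewrite inE iS.
have gtW i : i \in S' -> [forall w in W, (w < i)%N] = (i \in above) by move=> iS; rewrite inE iS.
have AB i : i \in above -> (i \in below) = false.
  by move=> iA; apply/negP => iB; have := below_above iB iA; rewrite ltnn.
have absE i : i \in S' -> absorb P W c a i =
  if (i \in below) && [forall j in S', (j \in below) ==> (j <= i)%N] then a i * c
  else if (i \in above) && [forall j in S', (i <= j)%N] then c * a i else a i.
  move=> iS; rewrite /absorb -/S' iS ltW// gtW//=; congr (if _ && _ then _ else _).
  by apply: eq_forallb_in => j jS; rewrite ltW.
have [B0|[b bB]] := set_0Vmem below.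
  rewrite B0 enum_set0 !big_nil !mul1r.
  have [h0 h0A] : exists i, i \in above.
    by have /set0Pn[i] := S'0; rewrite below_aboveE B0 set0U; exists i.
  have [h hA hmin] := @arg_minnP _ h0 (mem above) (@nat_of_ord n) h0A.
  rewrite /= in hA hmin.
  have e : enum above = h :: enum (above :\ h).
    rewrite -enum_min ?setD1K//; first by rewrite !inE eqxx.
    move=> i; rewrite in_setD1 => /andP[ih iA].
    by rewrite ltn_neqAle hmin// andbT eq_sym.
  rewrite e !big_cons absE ?inA//.
  rewrite AB//= hA /= ifT; last first.
    by apply/forall_inP => j; rewrite below_aboveE B0 set0U => /hmin.
  rewrite !mulrA; congr (_ * _); rewrite !big_seq; apply: eq_bigr => i.
  rewrite mem_enum in_setD1 => /andP[ih iA]; rewrite absE ?inA//.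
  rewrite AB//= iA /= ifF//; apply/negP => /forall_inP/(_ h).
  rewrite inA//; move=> /(_ isT) le.
  by case/eqP: ih; apply/val_inj/eqP; rewrite /= eqn_leq le hmin.
have [l lB lmax] := @arg_maxnP _ b (mem below) (@nat_of_ord n) bB.
rewrite /= in lB lmax.
have e : enum below = enum (below :\ l) ++ [:: l].
  rewrite -(enum_set1 l) -enum_setU ?[_ :|: [set l]]setUC ?setD1K// => i j.
  rewrite in_setD1 => /andP[il iB] /set1P->.
  by rewrite ltn_neqAle il lmax.
rewrite e !big_cat /= !big_seq1 absE ?inB//.
rewrite lB /= ifT; last first.
  by apply/forall_inP => j _; apply/implyP => /lmax.
rewrite !mulrA; congr (_ * _ * _ * _); rewrite !big_seq; apply: eq_bigr => i.
  rewrite mem_enum in_setD1 => /andP[il iB]; rewrite absE ?inB//.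
  rewrite iB /= ifF; last first.
    apply/negP => /forall_inP/(_ l); rewrite inB//.
    move=> /(_ isT)/implyP/(_ lB) le.
    by case/eqP: il; apply/val_inj/eqP; rewrite /= eqn_leq le lmax.
  by rewrite ifF//; apply/negP => /andP[/AB]; rewrite iB.
rewrite mem_enum => iA; rewrite absE ?inA//.
rewrite AB//= iA /= ifF//; apply/negP => /forall_inP/(_ l).
rewrite inB//; move=> /(_ isT).
by rewrite leqNgt below_above.
Qed.

End Absorb.

Lemma sum_subset_split (M : zmodType) n (S W : {set 'I_n}) (F : {set 'I_n} -> M) :
  W \subset S ->
  \sum_(T : {set 'I_n} | T \subset S) F T =
  \sum_(T1 : {set 'I_n} | T1 \subset S :\: W) \sum_(T2 : {set 'I_n} | T2 \subset W) F (T1 :|: T2).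
Proof.
move=> WS; rewrite pair_big_dep /=.
rewrite (reindex_onto (fun p => p.1 :|: p.2) (fun T => (T :\: W, T :&: W))) /=; last first.
  by move=> T _; rewrite setUC setID.
apply: eq_bigl => -[T1 T2] /=; apply/andP/andP => -[].
  move=> TS /eqP[e1 e2]; split; first by rewrite -e1 setSD.
  by rewrite -e2 subsetIr.
rewrite subsetD => /andP[T1S T1W] T2W; split.
  by rewrite subUset T1S (subset_trans T2W).
apply/eqP; congr pair.
  rewrite setDUl (setDidPl T1W).
  by move: T2W; rewrite -setD_eq0 => /eqP ->; rewrite setU0.
by rewrite setIUl (setIidPl T2W) (disjoint_setI0 T1W) set0U.
Qed.

(** The arguments of the cumulants are sums [f true + f false] of two operators, and a
set [T] of positions selects one of them at each place. The predicate [letter]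
says which pairs are admitted; it has to be stable under absorbing a cumulant. The
moment and the cumulant of a selection are assumed, respectively shown, to be the
product of the selected operators times an integer that depends on the word of the
selection. *)
Section Cumulants.
Variables (A : pzRingType) (A0 B0 : A -> Prop) (E : A -> A) (kappa : seq A -> A).
Variables (letter : (bool -> A) -> Prop) (m w : seq bool -> int).
Hypothesis hkappa : is_free_cumulants A0 B0 E kappa.
Hypothesis letterA : forall f, letter f -> A0 (f true + f false).
Hypothesis letterMr : forall f c, letter f -> B0 c -> letter (fun e => f e * c).
Hypothesis letterMl : forall f c, letter f -> B0 c -> letter (fun e => c * f e).

Definition prodw n (f : 'I_n -> bool -> A) (T S : {set 'I_n}) : A :=
  \prod_(i <- enum S) f i (i \in T).

Definition cumulant_formula n := forall f : 'I_n -> bool -> A, (forall i, letter (f i)) ->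
  kappa [seq f i true + f i false | i <- enum 'I_n] =
    \sum_(T : {set 'I_n}) prodw f T setT *~ w (word T setT).

(** The formula for [#|W|] arguments, renumbered along the enumeration of [W]. *)
Lemma cumulant_block n (W : {set 'I_n}) (f : 'I_n -> bool -> A) :
  (forall i, letter (f i)) -> cumulant_formula #|W| ->
  kappa (block_args (fun i => f i true + f i false) W) =
    \sum_(T : {set 'I_n} | T \subset W) prodw f T W *~ w (word T W).
Proof.
move=> fA cum.
have eW : enum W = [seq enum_val i | i <- enum 'I_#|W|].
  apply/esym; have [->|[x0 x0W]] := set_0Vmem W.
    by rewrite enum_set0; apply: size0nil; rewrite size_map size_enum_ord cards0.
  apply: (@eq_from_nth _ x0) => [|i]; rewrite size_map size_enum_ord -?cardE// => iW.
  by rewrite (nth_map (Ordinal iW)) ?size_enum_ord// (enum_val_nth x0) nth_enum_ord.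
rewrite /block_args {1}eW -map_comp (cum (fun i => f (enum_val i))) => [|i]; last exact: fA.
pose h (T : {set 'I_#|W|}) : {set 'I_n} := [set enum_val i | i in T].
pose h' (T : {set 'I_n}) : {set 'I_#|W|} := [set i | enum_val i \in T].
have hE T i : (enum_val i \in h T) = (i \in T).
  by apply/imsetP/idP => [[j jT /enum_val_inj->]|iT]; [|exists i].
rewrite [RHS](reindex_onto h h'); last first.
  move=> T TW; apply/setP => i; apply/imsetP/idP => [[j + ->]|iT]; first by rewrite inE.
  have iW := subsetP TW i iT.
  by exists (enum_rank_in iW i); rewrite ?inE enum_rankK_in.
apply: eq_big => [T|T _].
  apply/esym/andP; split; first by apply/subsetP => _ /imsetP[i _ ->]; exact: enum_valP.
  by apply/eqP/setP => i; rewrite inE hE.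
have -> : word T setT = word (h T) W.
  by rewrite /word eW -map_comp enum_setT -enumT; apply: eq_map => i /=; rewrite hE.
congr (_ *~ _); rewrite /prodw eW big_map enum_setT -enumT.
by apply: eq_bigr => i _; rewrite hE.
Qed.

Lemma absorb_letter n (P : {set {set 'I_n}}) (W : {set 'I_n}) c (f : 'I_n -> bool -> A) i :
  B0 c -> (forall i, letter (f i)) -> letter (fun e => absorb P W c (fun j => f j e) i).
Proof.
move=> Bc fA; rewrite /absorb; set b1 := [&& _, _ & _]; set b2 := [&& _, _ & _].
by case: b1; [exact: letterMr|case: b2; [exact: letterMl|]].
Qed.

Lemma absorbD n (P : {set {set 'I_n}}) (W : {set 'I_n}) c (f g : 'I_n -> A) i :
  absorb P W c (fun j => f j + g j) i = absorb P W c f i + absorb P W c g i.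
Proof. by rewrite /absorb; case: ifP => _; rewrite ?mulrDl//; case: ifP => _; rewrite ?mulrDr. Qed.

Lemma word_sub n (T T' S : {set 'I_n}) :
  (forall i, i \in S -> (i \in T) = (i \in T')) -> word T S = word T' S.
Proof. by move=> e; apply/eq_in_map => i; rewrite mem_enum => /e. Qed.

(** Remove interval blocks one at a time. By [prod_absorb] the product of the removed
block returns to its place, so the ordered product over all positions is restored
and the coefficients multiply. *)
Lemma kappa_part_formula :
  exists kp : forall n, {set {set 'I_n}} -> ('I_n -> A) -> A,
  (forall n (a : 'I_n -> A), (0 < n)%N -> (forall i, A0 (a i)) ->
     kp n [set setT] a = kappa [seq a i | i <- enum 'I_n]) /\
  (forall n a, (0 < n)%N -> (forall i, A0 (a i)) ->
        E (\prod_(i < n) a i) = \sum_(P | ncpart P [set: 'I_n]%SET) kp n P a) /\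
  forall n (P : {set {set 'I_n}}) (S : {set 'I_n}) f, (forall i, letter (f i)) ->
    ncpart P S -> S != set0 -> (forall V, V \in P -> cumulant_formula #|V|) ->
    kp n P (fun i => f i true + f i false) =
      \sum_(T : {set 'I_n} | T \subset S) prodw f T S *~ \prod_(V in P) w (word T V).
Proof.
have [kp [k1 k2 k3 k4]] := hkappa; exists kp; split; last (split; first exact: k4).
  move=> n a n0 aA; rewrite k2//; last by apply/set0Pn; exists (Ordinal n0); rewrite inE.
  by rewrite /block_args enum_setT -enumT.
move=> n P S f; elim: {P}_.+1 {-2}P (ltnSn #|P|) S f => // N IH P PN S f fA.
move=> /[dup] /ncpartP h ncP S0 cum.
have covP : cover P = S by case/andP: ncP => /and3P[/eqP].
have [i0 i0S] := set0Pn _ S0; have [V0 V0P _] := ncp_cover h i0S.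
have [W WP Wint] := ncpart_interval h V0P.
have [i1 i1W] := ncp_neq0 h WP.
have W0 : W != set0 by apply/set0Pn; exists i1.
have [PW|PW] := eqVneq P [set W].
  have SW : S = W by rewrite -covP PW cover1.
  rewrite PW k2//; last by move=> i; exact: letterA.
  by rewrite cumulant_block// ?SW; [apply: eq_bigr => T _; rewrite big_set1|exact: cum].
have Wsub : W \subset S by apply/subsetP => i; exact: ncp_sub h _ _ WP.
set a := fun i => _ + _.
have aA i : A0 (a i) by exact: letterA.
rewrite (k3 _ _ _ _ aA _ _ Wint PW); [|by rewrite covP; case/andP: ncP|by case/andP: ncP].
rewrite cumulant_block//; last exact: cum.
set c := \sum_(T | _) _.
have Bc : B0 c.
  rewrite /c -cumulant_block//; last exact: cum.
  apply: k1; first by rewrite size_map -cardE card_gt0.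
  by move=> _ /mapP[i _ ->]; exact: aA.
pose g i e := absorb P W c (fun j => f j e) i.
have -> : absorb P W c a = fun i => g i true + g i false.
  by apply/boolp.funext => i; rewrite -absorbD.
have hD1 := ncpartD1 h WP.
have S'0 : S :\: W != set0.
  have [V VP VW] : exists2 V, V \in P & V != W.
    apply/exists_inP; apply: contraR PW => /exists_inPn no; apply/eqP/setP => V.
    by rewrite inE; apply/idP/eqP => [/no/negPn/eqP|->].
  have [i iV] := ncp_neq0 h VP; apply/set0Pn; exists i; rewrite inE (ncp_sub h VP iV) andbT.
  by apply: contraNN VW => iW; rewrite (ncp_uniq h VP WP iV iW).
have cardP : (#|P :\ W| < N)%N by move: PN; rewrite (cardsD1 W P) WP.
have gA i : letter (g i) by exact: absorb_letter.
have cum' V : V \in P :\ W -> cumulant_formula #|V| by rewrite !inE => /andP[_]; exact: cum.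
have ncP' : ncpart (P :\ W) (S :\: W) by exact/ncpartP.
rewrite (IH _ cardP _ g gA ncP' S'0 cum').
rewrite (sum_subset_split _ Wsub); apply: eq_bigr => T1 T1S.
have -> : prodw g T1 (S :\: W) = (\prod_(i <- enum (below P W)) f i (i \in T1)) * c *
    (\prod_(i <- enum (above P W)) f i (i \in T1)).
  by rewrite -prod_absorb ?covP.
rewrite /c mulr_sumr mulr_suml mulrz_suml; apply: eq_bigr => T2 T2W.
rewrite mulrzAr mulrzAl -mulrzA [in RHS](bigD1 W)//=; congr (_ *~ (_ * _)).
- have T2n i : i \in S :\: W -> (i \in T1) = (i \in T1 :|: T2).
    rewrite in_setD in_setU => /andP[iW _]; rewrite orbC; case: (boolP (i \in T2)) => // iT2.
    by rewrite (subsetP T2W) in iW.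
  rewrite /prodw -covP (cover_enum W0 Wint) ?covP// !big_cat /= mulrA; congr (_ * _ * _).
  + rewrite !big_seq; apply: eq_bigr => i; rewrite mem_enum inE covP => /andP[iS _].
    by rewrite T2n.
  + rewrite !big_seq; apply: eq_bigr => i; rewrite mem_enum => iW.
    rewrite in_setU; case: (boolP (i \in T1)) => // /(subsetP T1S).
    by rewrite inE iW.
  + rewrite !big_seq; apply: eq_bigr => i; rewrite mem_enum inE covP => /andP[iS _].
    by rewrite T2n.
- congr w; apply: word_sub => i iW; rewrite in_setU; case: (boolP (i \in T1)) => // /(subsetP T1S).
  by rewrite inE iW.
- apply: eq_big => [V|V /setD1P[VW VP]]; first by rewrite !inE andbC.
  congr w; apply: word_sub => i iV; rewrite in_setU orbC; case: (boolP (i \in T2)) => // iT2.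
  case/eqP: VW; exact: (ncp_uniq h VP WP iV (subsetP T2W _ iT2)).
Qed.

Hypothesis moments : forall n (f : 'I_n -> bool -> A), (0 < n)%N -> (forall i, letter (f i)) ->
  E (\prod_(i < n) (f i true + f i false)) =
    \sum_(T : {set 'I_n}) prodw f T setT *~ m (word T setT).
Hypothesis ncw : forall n (T : {set 'I_n}),
  ncsum (fun V => w (word T V)) setT = m (word T setT).

(** In the moment-cumulant formula the full block is the only term that is not known
by induction, both for the cumulants and for their coefficients. *)
Lemma cumulantE n : (0 < n)%N -> cumulant_formula n.
Proof.
have [kp [kp1 [kpE kpf]]] := kappa_part_formula.
have [k] := ubnP n; elim: k n => // k IH n nk n0 f fA.
have aA i : A0 (f i true + f i false) by exact: letterA.
have nz : [set: 'I_n] != set0 by apply/set0Pn; exists (Ordinal n0); rewrite inE.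
have setTp : ncpart [set setT] [set: 'I_n].
  apply/ncpartP; split.
  - by move=> V /set1P ->; apply/set0Pn.
  - by move=> V i _; rewrite inE.
  - by move=> i _; exists setT; rewrite ?inE.
  - by move=> V W i /set1P -> /set1P ->.
  - by move=> V W i j l p /set1P -> /set1P ->.
have := moments n0 fA; rewrite kpE// (bigD1 [set setT])//= kp1// => /(canRL (addrK _)) ->.
have small P V : ncpart P [set: 'I_n] -> P != [set setT] -> V \in P -> cumulant_formula #|V|.
  move=> /ncpartP h PT VP; apply: IH; last by rewrite card_gt0; apply/set0Pn; exact: (ncp_neq0 h VP).
  rewrite -ltnS; apply: leq_trans nk; rewrite ltnS -[X in (_ < X)%N]card_ord -cardsT.
  apply: proper_card; rewrite properT; apply: contraNneq PT => VT; apply/eqP/setP => W.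
  rewrite inE; apply/idP/eqP => [WP|->]; last by rewrite -VT.
  have [i iW] := ncp_neq0 h WP.
  by rewrite (ncp_uniq h WP VP iW)// VT inE.
have -> : \sum_(P | ncpart P [set: 'I_n] && (P != [set setT])) kp n P (fun i => f i true + f i false)
  = \sum_(P | ncpart P [set: 'I_n] && (P != [set setT]))
      \sum_(T : {set 'I_n}) prodw f T setT *~ \prod_(V in P) w (word T V).
  apply: eq_bigr => P /andP[ncP PT]; rewrite (kpf _ _ setT)//; last by move=> V; exact: small ncP PT.
  by apply: eq_bigl => T; rewrite subsetT.
rewrite exchange_big /= -sumrB; apply: eq_bigr => T _.
rewrite -mulrz_sumr -mulrzBr; congr (_ *~ _).
by rewrite -ncw /ncsum (bigD1 [set setT])//= big_set1 addrK.
Qed.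

End Cumulants.

(** * The two alternating words *)

Section AlternatingWords.
Variable n : nat.

Definition altset (e : bool) : {set 'I_n} := [set i : 'I_n | e (+) odd i].

Lemma nth_word (T : {set 'I_n}) (i : 'I_n) : nth false (word T setT) i = (i \in T).
Proof.
rewrite /word enum_setT -enumT (nth_map i) ?size_enum_ord//.
by rewrite nth_ord_enum.
Qed.

Lemma size_word (T : {set 'I_n}) : size (word T setT) = n.
Proof. by rewrite size_map -cardE cardsT card_ord. Qed.

Lemma alternating_altset e : alternating (word (altset e) setT).
Proof.
apply/(sortedP false) => i; rewrite size_word => iN.
have := nth_word (altset e) (Ordinal iN); have := nth_word (altset e) (Ordinal (ltnW iN)).
by rewrite !inE /= => -> ->; case: e (odd i) => -[].
Qed.

Lemma alternatingE (T : {set 'I_n}) : alternating (word T setT) ->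
  T = altset true \/ T = altset false.
Proof.
move=> /(sortedP false); rewrite size_word => alt.
pose e := nth false (word T setT) 0.
suff : T = altset e by case: e => ->; [left|right].
apply/setP => i; rewrite inE -nth_word.
case: i => i iN /=; elim: i iN => [|i IH] iN; first by rewrite addbF.
have := alt i iN; rewrite IH ?(ltnW iN)// /= addbN.
by case: (nth _ _ _) (_ (+) _) => -[].
Qed.

Lemma sum_alt_weight (A : pzRingType) (F : {set 'I_n} -> A) : (0 < n)%N ->
  \sum_(T : {set 'I_n}) F T *~ alt_weight 0 (word T setT) =
  (F (altset true) + F (altset false)) *~ signed_ballot n.-1 0.
Proof.
move=> n0; rewrite (bigD1 (altset true))//= (bigD1 (altset false)) /=; last first.
  apply/eqP => /setP/(_ (Ordinal n0)); by rewrite !inE.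
rewrite big1 => [|T /andP[T1 T2]].
  by rewrite addr0 /alt_weight !alternating_altset !size_word add0n mulrzDl.
rewrite /alt_weight; case: ifP => // /alternatingE[] TE; first by rewrite TE eqxx in T1.
by rewrite TE eqxx in T2.
Qed.

End AlternatingWords.

Lemma prodw_setT (A : pzRingType) n (f : 'I_n -> bool -> A) T :
  prodw f T setT = \prod_(i < n) f i (i \in T).
Proof. by rewrite /prodw enum_setT [index_enum _]unlock. Qed.

Section AlternatingProducts.
Variables (A : pzRingType) (U : bool -> A) (b : A).

Lemma prod_alt_even e k :
  \prod_(i < k.*2) (U (e (+) odd i) * b) = (U e * b * (U (~~ e) * b)) ^+ k.
Proof.
elim: k => [|k IH]; first by rewrite big_ord0.
rewrite doubleS !big_ord_recr /= IH exprSr odd_double addbF addbT.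
by rewrite !mulrA.
Qed.

(** The arguments (x b, ..., x b, x) of the R-transform: the last one has no [b]. *)
Definition rtransform_letter n (i : 'I_n.+1) e := U e * (if i == ord_max then 1 else b).

Lemma prodw_rtransform_letter k e :
  prodw (@rtransform_letter k.*2.+1) (altset _ e) setT =
    (U e * b * (U (~~ e) * b)) ^+ k * (U e * b * U (~~ e)).
Proof.
rewrite prodw_setT !big_ord_recr /=.
rewrite /rtransform_letter eqxx !inE /= odd_double addbF addbT mulr1 -prod_alt_even !mulrA.
congr (_ * _); rewrite -!mulrA; congr (_ * _).
  apply: eq_bigr => i _; rewrite inE /= ifF//; apply/negP => /eqP/(congr1 val) /=.
  by have := ltn_ord i; lia.
by rewrite ifF//; apply/negP => /eqP/(congr1 val) /=; lia.
Qed.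

End AlternatingProducts.

(** * Catalan numbers *)

Lemma central_bin_rec m : (m.+1 * 'C(m.+1.*2, m.+1) = 2 * m.*2.+1 * 'C(m.*2, m))%N.
Proof.
have h1 := mul_bin_diag m.*2.+1 m; have h2 := bin_sub (leq_addr m.+1 m).
rewrite addKn addnS addnn in h2.
rewrite /= in h1; rewrite doubleS binS -h2; lia.
Qed.

Section Catalan.
Variable F : numFieldType.

(** Over any numeric field, since the series has complex coefficients but is bounded
by its real counterpart. *)
Definition catn m : F := m.+1%:R^-1 * 'C(m.*2, m)%:R.

Lemma catn_ge0 m : 0 <= catn m.
Proof. by rewrite mulr_ge0 ?invr_ge0 ?ler0n. Qed.

Lemma catn0 : catn 0 = 1. Proof. by rewrite /catn bin0 invr1 mulr1. Qed.

Lemma catn_rec m : m.+2%:R * catn m.+1 = (4 * m + 2)%:R * catn m.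
Proof.
rewrite /catn mulrA mulfV ?mul1r ?pnatr_eq0//.
apply: (@mulfI _ m.+1%:R); first by rewrite pnatr_eq0.
rewrite -natrM central_bin_rec mulrCA (mulrA m.+1%:R) mulfV ?mul1r ?pnatr_eq0//.
by rewrite -natrM; congr (_%:R); lia.
Qed.

Lemma catn_conv_sym m :
  2 * \sum_(i < m.+1) i%:R * (catn i * catn (m - i)) =
  m%:R * \sum_(i < m.+1) catn i * catn (m - i).
Proof.
rewrite mulr_natl mulr2n {2}(reindex_inj rev_ord_inj) /= -big_split mulr_sumr /=.
apply: eq_bigr => i _; have im : (i <= m)%N by rewrite -ltnS.
by rewrite subSS subKn// [catn (m - i) * _]mulrC -mulrDl -natrD subnKC.
Qed.

(** Segner's recurrence follows from the two-term recurrence [catn_rec]: multiply it by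
[catn (m - i)] and sum over [i]. By [catn_conv_sym] the factor [i] may be replaced
by [m / 2], which leaves a two-term recurrence for the convolution itself. *)
Lemma catn_conv m : \sum_(i < m.+1) catn i * catn (m - i) = catn m.+1.
Proof.
elim: m => [|m IH].
  have := catn_rec 0; rewrite big_ord1 catn0 !mulr1 muln0 add0n => e.
  by apply: (@mulfI _ 2); rewrite ?pnatr_eq0// e mulr1.
set D := \sum_(i < _) _.
have e1 : \sum_(i < m.+2) (i%:R + 1) * (catn i * catn (m.+1 - i)) =
    catn m.+1 + \sum_(i < m.+1) (4 * i + 2)%:R * (catn i * catn (m - i)).
  rewrite big_ord_recl /= add0r mul1r catn0 mul1r subn0; congr (_ + _).
  apply: eq_bigr => i _; rewrite /bump /= add1n subSS natr1 mulrA catn_rec mulrA//.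
have e2 : \sum_(i < m.+2) (i%:R + 1) * (catn i * catn (m.+1 - i)) =
    \sum_(i < m.+2) i%:R * (catn i * catn (m.+1 - i)) + D.
  by rewrite -big_split; apply: eq_bigr => i _; rewrite mulrDl mul1r.
have e3 : \sum_(i < m.+1) (4 * i + 2)%:R * (catn i * catn (m - i)) =
    4 * (\sum_(i < m.+1) i%:R * (catn i * catn (m - i))) + 2 * catn m.+1.
  rewrite -IH !mulr_sumr -big_split; apply: eq_bigr => i _.
  by rewrite natrD natrM /=; ring.
have s1 := catn_conv_sym m; have s2 := catn_conv_sym m.+1.
rewrite IH in s1; rewrite -/D in s2.
have r := catn_rec m.+1.
have n0 : m.+3%:R != 0 :> F by rewrite pnatr_eq0.
apply: (mulfI n0); rewrite r.
have e4 : m.+3%:R * D = 2 * (\sum_(i < m.+2) i%:R * (catn i * catn (m.+1 - i)) + D).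
  by rewrite mulrDr s2 -mulrDl -natrD; congr (_%:R * _); lia.
rewrite e4 -e2 e1 e3 !mulrDr (_ : 2 * (4 * _) = 4 * (m%:R * catn m.+1)); last first.
  by rewrite -s1; ring.
by rewrite natrD natrM -[m.+1]addn1 natrD; ring.
Qed.

Lemma sum_triangle (V : zmodType) (y : nat -> nat -> V) M :
  \sum_(m < M) \sum_(i < m.+1) y i (m - i)%N = \sum_(i < M) \sum_(j < M - i) y i j.
Proof.
elim: M => [|M IH]; first by rewrite !big_ord0.
rewrite big_ord_recr /= {}IH [in RHS]big_ord_recr /= subSnn big_ord1.
rewrite [X in _ + X = _]big_ord_recr /= subnn addrA; congr (_ + _).
rewrite -big_split; apply: eq_bigr => i _ /=.
by rewrite subSn ?big_ord_recr//= ltnW.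
Qed.

Lemma signed_ballot_catn k : (signed_ballot k.*2.+1 0)%:~R = (-1) ^+ k * catn k.
Proof.
have k0 : k.+1%:R != 0 :> F by rewrite pnatr_eq0.
apply: (mulIf k0); have /(congr1 (fun z : int => z%:~R : F)) := signed_ballot_catalan k.
rewrite !rmorphM /= rmorphXn /= rmorphN1 -!pmulrn => ->.
by rewrite /catn; field; rewrite nat1r.
Qed.

End Catalan.

(** With a m the central binomial coefficient divided by 4^m, the terms are
2 (a m - a (m + 1)), so the sum telescopes. *)
Lemma catn_sum_le (F : realFieldType) M : \sum_(m < M) catn F m * 4^-1 ^+ m <= 2.
Proof.
pose a m : F := 'C(m.*2, m)%:R * 4^-1 ^+ m.
have step m : catn F m * 4^-1 ^+ m = 2 * (a m - a m.+1).
  have m1 : m.+1%:R != 0 :> F by rewrite pnatr_eq0.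
  have e : 'C(m.+1.*2, m.+1)%:R = m.+1%:R^-1 * ((4 * m + 2)%:R * 'C(m.*2, m)%:R) :> F.
    apply: (mulfI m1); rewrite mulVKf// -!natrM central_bin_rec.
    by congr (_%:R); lia.
  rewrite /a e /catn exprS natrD natrM -[m.+1]addn1 natrD in m1 *; field.
  by move: m1; rewrite addrC.
suff -> : \sum_(m < M) catn F m * 4^-1 ^+ m = 2 * (1 - a M).
  by rewrite ler_piMr// gerBl mulr_ge0// exprn_ge0// invr_ge0.
elim: M => [|M IH]; first by rewrite big_ord0 /a bin0 expr0 mulr1 subrr mulr0.
by rewrite big_ord_recr /= IH step; ring.
Qed.

(** * Completeness of the space and of its bounded operators *)

From mathcomp Require Import finmap complex.
From mathcomp Require Import all_classical all_reals all_analysis summability.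
Import Order.TTheory GRing.Theory Num.Theory.
Import numFieldNormedType.Exports.
Import ComplexField.Normc.
Local Open Scope classical_set_scope.
Local Open Scope ring_scope.

(** Here [rho] is a modulus of convergence, stated without filters because it is used
with explicit geometric bounds only. *)
Section Completeness.
Variable R : realType.
Variable rho : nat -> R.
Hypothesis rho_ge0 : forall n, 0 <= rho n.
Hypothesis rho_small : forall e n, 0 < e -> exists2 m, (n <= m)%N & rho m < e.

(** The supremum of the lower bounds [r n - rho n] lies below every upper bound
[r m + rho m]. *)
Lemma real_limit (r : nat -> R) : (forall n m, (n <= m)%N -> `|r m - r n| <= rho n) ->
  exists l, forall n, `|l - r n| <= rho n.
Proof.
move=> rc; pose A := [set r n - rho n | n in setT].
have ub n m : r n - rho n <= r m + rho m.
  have [nm|mn] := leqP n m.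
    have := rc _ _ nm; have := rho_ge0 m; rewrite ler_norml => ? /andP[]; lra.
  have := rc _ _ (ltnW mn); have := rho_ge0 n; rewrite ler_norml => ? /andP[]; lra.
exists (sup A) => n; rewrite ler_norml.
have supA : has_sup A.
  split; first by exists (r 0%N - rho 0%N); exists 0%N.
  by exists (r 0%N + rho 0%N) => _ [m _ <-]; exact: ub.
have h1 : r n - rho n <= sup A by apply: (sup_upper_bound supA); exists n.
have h2 : sup A <= r n + rho n.
  by apply: ge_sup => [|_ [m _ <-]]; [exact: supA.1|exact: ub].
lra.
Qed.

Lemma normc_re_im (z : R[i]) : normc z <= `|complex.Re z| + `|complex.Im z|.
Proof.
case: z => a b /=; rewrite -(ger0_norm (addr_ge0 (normr_ge0 a) (normr_ge0 b))) -sqrtr_sqr.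
apply: ler_wsqrtr; rewrite sqrrD !real_normK ?num_real//.
by rewrite addrAC lerDl mulrn_wge0// mulr_ge0.
Qed.

Lemma normr_re_le (z : R[i]) : `|complex.Re z| <= normc z.
Proof.
by case: z => a b /=; rewrite -sqrtr_sqr ler_wsqrtr// lerDl sqr_ge0.
Qed.

Lemma normr_im_le (z : R[i]) : `|complex.Im z| <= normc z.
Proof.
by case: z => a b /=; rewrite -sqrtr_sqr ler_wsqrtr// lerDr sqr_ge0.
Qed.

Lemma complex_limit (r : nat -> R[i]) :
  (forall n m, (n <= m)%N -> normc (r m - r n) <= rho n) ->
  exists l, forall n, normc (l - r n) <= 2 * rho n.
Proof.
move=> rc.
have [n m nm|a aP] := @real_limit (fun n => complex.Re (r n)).
  by apply: le_trans (rc _ _ nm); rewrite -raddfB; exact: normr_re_le.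
have [n m nm|b bP] := @real_limit (fun n => complex.Im (r n)).
  by apply: le_trans (rc _ _ nm); rewrite -raddfB; exact: normr_im_le.
exists (Complex a b) => n; apply: le_trans (normc_re_im _) _.
rewrite mulr2n mulrDl mul1r; apply: lerD; first by case: (r n) (aP n).
by case: (r n) (bP n).
Qed.

Variable G : choiceType.

Lemma sqnorm_le (f : G -> R[i]^o) (M : R) :
  (forall s : seq G, uniq s -> \sum_(x <- s) normc (f x) ^+ 2 <= M) -> (sqnorm f <= M%:E)%E.
Proof.
move=> fM; rewrite /sqnorm /esum; apply: ge_ereal_sup => _ [A [Af _] <-].
by rewrite fsumEFin// lee_fin fsbig_finite//=; exact: fM (fset_uniq _).
Qed.

Lemma le_sqnorm (f : G -> R[i]^o) (s : seq G) : uniq s ->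
  ((\sum_(x <- s) normc (f x) ^+ 2)%:E <= sqnorm f)%E.
Proof.
move=> us; apply: esum_ge; exists [set` s]; first by split.
rewrite fsumEFin//.
by rewrite lee_fin -(fsbig_seq _ _ us).
Qed.

Lemma sqnorm_rnorm (f : ell2 R G) : sqnorm f = ((complex.Re `|f|) ^+ 2)%:E.
Proof. exact: ell2_norm_subproof. Qed.

(** The limit exists at each point of [G]. On a finite set of points the pointwise
limit is compared with a term [f m] so late that its error on this set is
negligible, and [f m] with [f n] in norm; the square of the sum of the two errors
costs a factor 2, whence the constant in the conclusion. *)
Lemma ell2_limit (f : nat -> ell2 R G) :
  (forall n m, (n <= m)%N -> complex.Re `|f m - f n| <= rho n) ->
  exists l : ell2 R G, forall n, complex.Re `|l - f n| <= 2 * rho n.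
Proof.
move=> fc.
have fs n m s : (n <= m)%N -> uniq s -> \sum_(x <- s) normc (f m x - f n x) ^+ 2 <= rho n ^+ 2.
  move=> nm us; rewrite -lee_fin; apply: (le_trans (le_sqnorm (fun x => f m x - f n x) us)).
  rewrite -[sqnorm _]/(sqnorm (f m - f n)) sqnorm_rnorm lee_fin ler_sqr ?nnegrE//; first exact: fc.
  exact: sqrtr_ge0.
have /choice[l lP] x : exists z : R[i], forall n, normc (z - f n x) <= 2 * rho n.
  apply: complex_limit => n m nm; rewrite -ler_sqr ?nnegrE ?normc_ge0//.
  by have := fs n m [:: x] nm isT; rewrite big_seq1.
have ls n : (sqnorm (fun x => (l x - f n x)%R : R[i]^o) <= ((2 * rho n) ^+ 2)%:E)%E.
  apply: sqnorm_le => s us; apply/ler_addgt0Pr => e e0.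
  have d0 : 0 < e / (8 * (size s).+1%:R).
    by rewrite divr_gt0// mulr_gt0.
  have [m nm rm] : exists2 m, (n <= m)%N & rho m ^+ 2 <= e / (8 * (size s).+1%:R).
    have dm : 0 < Num.min (e / (8 * (size s).+1%:R)) 1 by rewrite lt_min d0 ltr01.
    have [m nm rm] := rho_small n dm.
    exists m => //; move: rm; rewrite lt_min => /andP[rd r1].
    by apply: le_trans (ltW rd); rewrite expr2 ler_piMr// ltW.
  apply: (@le_trans _ _ (\sum_(x <- s) (2 * normc (l x - f m x) ^+ 2 + 2 * normc (f m x - f n x) ^+ 2))).
    apply: ler_sum => x _; have := @le_normcD R (l x - f m x) (f m x - f n x).
    rewrite addrA subrK; set p := normc (_ - f n x); set a := normc _; set b := normc _.
    have p0 : 0 <= p by exact: normc_ge0.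
    move=> pab; have : p ^+ 2 <= (a + b) ^+ 2 by rewrite ler_sqr ?nnegrE// (le_trans p0).
    move/le_trans; apply; have := sqr_ge0 (a - b); rewrite sqrrB sqrrD; lra.
  rewrite big_split /= -!mulr_sumr.
  have h1 : \sum_(x <- s) normc (l x - f m x) ^+ 2 <= (size s)%:R * (4 * rho m ^+ 2).
    rewrite mulr_natl -iter_addr_0 -(count_predT s) -big_const_seq; apply: ler_sum => x _.
    have -> : 4 * rho m ^+ 2 = (2 * rho m) ^+ 2 by rewrite exprMn; congr (_ * _); ring.
    by rewrite ler_sqr ?nnegrE ?normc_ge0 ?mulr_ge0.
  have h2 := fs n m s nm us.
  have h3 : (size s)%:R * (4 * rho m ^+ 2) <= e / 2.
    apply: (@le_trans _ _ ((size s).+1%:R * (4 * (e / (8 * (size s).+1%:R))))).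
      apply: ler_pM => //; rewrite ?mulr_ge0 ?sqr_ge0 ?ler_nat//.
      by rewrite ler_pM2l.
    rewrite le_eqVlt; apply/orP; left; apply/eqP; have : (size s).+1%:R != 0 :> R by rewrite pnatr_eq0.
    by move: (_.+1%:R) => N N0; field.
  have := sqr_ge0 (rho n); rewrite exprMn; lra.
have l2 : (l : G -> R[i]^o) \in @sqsummable R G.
  have -> : (l : G -> R[i]^o) = (fun x => l x - f 0%N x) + (f 0%N : G -> R[i]^o).
    by apply/funext => x; rewrite -[RHS]/(l x - f 0%N x + f 0%N x) subrK.
  apply: rpredD; last exact: ell2P.
  by rewrite inE (le_lt_trans (ls 0%N))// ltry.
exists (Ell2 l2) => n; rewrite -ler_sqr ?nnegrE ?mulr_ge0//; last exact: sqrtr_ge0.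
by rewrite -lee_fin -sqnorm_rnorm; exact: ls.
Qed.

End Completeness.

Section OperatorNorm.
Variables (R : realType) (G : groupType).
Local Notation A := (bop R G).
Implicit Types (S T : A) (x y : ell2 R G).

Lemma normbE T : `|T| = (opnorm T)%:C%C. Proof. by []. Qed.

Lemma opnormD S T : opnorm (S + T) <= opnorm S + opnorm T.
Proof. by rewrite -lecR rmorphD /= -!normbE ler_normD. Qed.

Lemma opnormN T : opnorm (- T) = opnorm T.
Proof. by apply: complexI; rewrite -!normbE normrN. Qed.

Lemma opnormZ (c : R[i]) T : opnorm (c *: T) = normc c * opnorm T.
Proof. by apply: complexI; rewrite -normbE normrZ rmorphM. Qed.

Lemma opnorm0 : opnorm (0 : A) = 0.
Proof. by apply: complexI; rewrite -normbE normr0. Qed.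

Lemma opnorm_eq0 T : opnorm T <= 0 -> T = 0.
Proof.
move=> T0; apply/eqP; rewrite -normr_eq0 normbE; apply/eqP; congr (_%:C%C).
by apply/eqP; rewrite eq_le T0 opnorm_ge0.
Qed.

Lemma opnormM S T : opnorm (S * T) <= opnorm S * opnorm T.
Proof.
apply: opnorm_le => [|x]; first by rewrite mulr_ge0 ?opnorm_ge0.
rewrite -[(S * T) x]/(S (T x)) (le_trans (opnormP _ _))// -mulrA.
by rewrite ler_wpM2l ?opnorm_ge0// opnormP.
Qed.

Lemma opnorm1 : opnorm (1 : A) <= 1.
Proof. by apply: opnorm_le => // x; rewrite mul1r. Qed.

Lemma opnormX T n : opnorm (T ^+ n) <= opnorm T ^+ n.
Proof.
elim: n => [|n IH]; first by rewrite !expr0 opnorm1.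
by rewrite !exprS (le_trans (opnormM _ _))// ler_wpM2l ?opnorm_ge0.
Qed.

Lemma opnorm_sum I (s : seq I) (P : pred I) (F : I -> A) :
  opnorm (\sum_(i <- s | P i) F i) <= \sum_(i <- s | P i) opnorm (F i).
Proof.
elim/big_rec2: _ => [|i a b _ h]; first by rewrite opnorm0.
by rewrite (le_trans (opnormD _ _))// lerD2l.
Qed.

Lemma bop_cvgP (f : nat -> A) T :
  f @ \oo --> T <-> forall e, 0 < e -> exists N, forall n, (N <= n)%N -> opnorm (T - f n) < e.
Proof.
split=> [/cvgrPdist_lt fT e e0|fT].
  have [|N _ NP] := fT e%:C%C; first by rewrite ltcR.
  by exists N => n Nn; have := NP n Nn; rewrite /= normbE ltcR.
apply/cvgrPdist_lt => e e0.
have eE : e = (complex.Re e)%:C%C by case: e e0 => a b; rewrite ltcE /= => /andP[/eqP->].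
rewrite eE ltcR in e0.
have [N NP] := fT _ e0; exists N => // n Nn.
by rewrite /= eE normbE ltcR NP.
Qed.

(** The limit is taken at each vector; linearity and boundedness pass to it because the
rate is uniform on the unit ball. *)
Lemma bop_limit (rho : nat -> R) (f : nat -> A) :
  (forall n, 0 <= rho n) ->
  (forall e n, 0 < e -> exists2 m, (n <= m)%N & rho m < e) ->
  (forall n m, (n <= m)%N -> opnorm (f m - f n) <= rho n) ->
  exists T, forall n, opnorm (T - f n) <= 2 * rho n.
Proof.
move=> rho0 rhos fc.
have /choice[T TP] x : exists y : ell2 R G, forall n, rnorm (y - f n x) <= 2 * (rho n * rnorm x).
  apply: (@ell2_limit _ (fun n => rho n * rnorm x)) => [n|e n e0|n m nm].
  - by rewrite mulr_ge0 ?rnorm_ge0.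
  - have x1 : 0 < rnorm x + 1 by rewrite ltr_wpDl// rnorm_ge0.
    have [|m nm rm] := rhos (e / (rnorm x + 1)) n; first by rewrite divr_gt0.
    exists m => //; move: rm; rewrite ltr_pdivlMr//; apply: le_lt_trans.
    by rewrite ler_wpM2l// lerDl.
  - rewrite -[complex.Re _]/(rnorm _) (_ : f m x - f n x = (f m - f n) x)//.
    by rewrite (le_trans (opnormP _ _))// ler_wpM2r ?rnorm_ge0// fc.
have Tlin : linear T.
  move=> c x y; apply/eqP; rewrite -subr_eq0 -normr_eq0 rnormE; apply/eqP; congr (_%:C%C).
  apply/eqP; rewrite eq_le rnorm_ge0 andbT; apply/ler_addgt0Pr => e e0; rewrite add0r.
  pose K := 2 * (rnorm (c *: x + y) + normc c * rnorm x + rnorm y).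
  have K0 : 0 <= K by rewrite mulr_ge0 ?addr_ge0 ?mulr_ge0 ?rnorm_ge0 ?normc_ge0.
  have [|m _ rm] := rhos (e / (K + 1)) 0%N; first by rewrite divr_gt0// ltr_wpDl.
  apply: (@le_trans _ _ (rho m * K)); last first.
    move: rm; rewrite ltr_pdivlMr ?ltr_wpDl// => rm; apply: le_trans (ltW rm).
    by rewrite ler_wpM2l// lerDl.
  have -> : T (c *: x + y) - (c *: T x + T y) =
    (T (c *: x + y) - f m (c *: x + y)) + ((- c) *: (T x - f m x) + (-1) *: (T y - f m y)).
    rewrite scaleNr scaleN1r scalerBr !opprB (addrACA (c *: f m x)) -opprD (bop_linear (f m)).
    by rewrite (addrA (T _ - _)) subrK.
  rewrite (le_trans (rnormD _ _))// (_ : rho m * K = 2 * (rho m * rnorm (c *: x + y)) +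
     (normc c * (2 * (rho m * rnorm x)) + 2 * (rho m * rnorm y))); last by rewrite /K; ring.
  rewrite lerD// (le_trans (rnormD _ _))// lerD// rnormZ.
    by rewrite normcN ler_wpM2l ?normc_ge0.
  by rewrite normcN normc1 mul1r.
have Tb : T \in @bounded_linear R G.
  apply/asboolP; split=> //; exists (2 * rho 0%N + opnorm (f 0%N)) => x.
  have -> : T x = (T x - f 0%N x) + f 0%N x by rewrite subrK.
  apply: le_trans (rnormD _ _) _; rewrite mulrDl.
  by apply: lerD; [rewrite -mulrA; exact: TP|exact: opnormP].
exists (Bop Tb) => n; apply: opnorm_le => [|x]; first by rewrite mulr_ge0.
by rewrite -mulrA; exact: TP.
Qed.

Lemma geometric_tail (r : R) n m : 0 <= r < 1 -> (n <= m)%N ->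
  \sum_(n <= k < m) r ^+ k <= r ^+ n / (1 - r).
Proof.
move=> /andP[r0 r1]; have r1' : 0 < 1 - r by rewrite subr_gt0.
suff H : forall m, (n <= m)%N -> \sum_(n <= k < m) r ^+ k = (r ^+ n - r ^+ m) / (1 - r).
  move=> nm; rewrite H// ler_pM2r ?invr_gt0// lerBlDr lerDl exprn_ge0//.
elim=> [|k IHk]; first by rewrite leqn0 => /eqP ->; rewrite big_geq// subrr mul0r.
rewrite leq_eqVlt => /orP[/eqP->|]; first by rewrite big_geq// subrr mul0r.
rewrite ltnS => nk; rewrite big_nat_recr//= IHk// exprS; field.
by rewrite lt0r_neq0.
Qed.

Lemma pow_small (r C e : R) n : 0 <= r < 1 -> 0 <= C -> 0 < e ->
  exists2 m, (n <= m)%N & C * r ^+ m < e.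
Proof.
move=> /andP[r0 r1] C0 e0.
have C1 : 0 < C + 1 by rewrite ltr_wpDl.
have : (GRing.exp r) @ \oo --> (0 : R) by apply: cvg_expr; rewrite ger0_norm.
move/cvgrPdist_lt/(_ (e / (C + 1))) => [|N _ NP]; first by rewrite divr_gt0.
exists (maxn n N); first by rewrite leq_maxl.
have := NP _ (leq_maxr n N); rewrite /= sub0r normrN ger0_norm ?exprn_ge0//.
rewrite ltr_pdivlMr// mulrC; apply: le_lt_trans.
by rewrite ler_wpM2r ?exprn_ge0// lerDl.
Qed.

Lemma bop_series (u : nat -> A) (C r : R) : 0 <= C -> 0 <= r < 1 ->
  (forall k, opnorm (u k) <= C * r ^+ k) -> exists T, series u @ \oo --> T.
Proof.
move=> C0 rr uC; have /andP[r0 r1] := rr.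
have C10 : 0 <= C / (1 - r) by rewrite divr_ge0// subr_ge0 ltW.
have [n|e n e0|n m nm|T TP] := @bop_limit (fun n => C / (1 - r) * r ^+ n) (series u).
- by rewrite mulr_ge0 ?exprn_ge0.
- exact: pow_small.
- rewrite sub_series_geq// (le_trans (opnorm_sum _ _ _))//.
  apply: (@le_trans _ _ (C * \sum_(n <= k < m) r ^+ k)).
    by rewrite mulr_sumr; apply: ler_sum => k _.
  rewrite (_ : C / (1 - r) * r ^+ n = C * (r ^+ n / (1 - r))); last by ring.
  by rewrite ler_wpM2l// geometric_tail.
exists T; apply/bop_cvgP => e e0.
have C20 : 0 <= 2 * (C / (1 - r)) by rewrite mulr_ge0.
have [N _ NP] := pow_small 0 rr C20 e0.
exists N => n Nn; apply: le_lt_trans (TP n) (le_lt_trans _ NP).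
rewrite (mulrA 2 (C / (1 - r))); apply: ler_wpM2l => //.
by apply: ler_wiXn2l => //; exact: ltW.
Qed.

End OperatorNorm.

(** * Translations and the reduced C*-algebra of a subgroup *)

Lemma partial_sumE (I : choiceType) (V : zmodType) (F : I -> V) (B : {fset I}) :
  partial_sum F B = \sum_(i <- B) F i.
Proof. by rewrite big_seq_fsetE. Qed.

(** A bijection permutes the finite sets along which the sum converges. *)
Lemma sum_reindex (I : choiceType) (K : numDomainType) (V : normedModType K)
    (F : I -> V) (phi psi : I -> I) : cancel phi psi -> cancel psi phi ->
  summability.sum (F \o phi) = summability.sum F.
Proof.
move=> phiK psiK; rewrite /summability.sum.
suff -> : partial_sum (F \o phi) @ totally = partial_sum F @ totally by [].
have ps (B : {fset I}) : partial_sum (F \o phi) B = partial_sum F [fset phi i | i in B]%fset.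
  by rewrite !partial_sumE big_imfset//= => i j _ _; exact: (can_inj phiK).
have imK (f g : I -> I) (B : {fset I}) : cancel g f -> [fset f i | i in [fset g i | i in B]]%fset = B.
  move=> gK; rewrite -imfset_comp; apply/fsetP => i; apply/imfsetP/idP => /= [[j jB ->]|iB].
    by rewrite gK.
  by exists i; rewrite ?gK.
apply/funext => P; apply/propext; split=> -[B _ BP].
  exists [fset phi i | i in B]%fset => // B' /= BB'.
  have := BP [fset psi i | i in B']%fset; rewrite /= ps (imK phi psi)//; apply.
  rewrite -(imK psi phi B)//; apply/fsubsetP => _ /imfsetP[i /= iB ->].
  by apply/imfsetP; exists i => //=; exact: (fsubsetP BB').
exists [fset psi i | i in B]%fset => // B' /= BB'; rewrite /= ps; apply: BP => /=.
rewrite -(imK phi psi B)//; apply/fsubsetP => _ /imfsetP[i /= iB ->].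
by apply/imfsetP; exists i => //=; exact: (fsubsetP BB').
Qed.

Lemma sum_single (I : choiceType) (R : realType) (F : I -> R[i]^o) (g : I) :
  (forall i, i != g -> F i = 0) -> summability.sum F = F g.
Proof.
move=> F0; apply: cvg_lim; first exact: norm_hausdorff.
  exact: totally_filter.
apply: cvg_near_cst.
  by have [] := @totally_filter I.
exists [fset g]%fset; first by [].
move=> B /=; rewrite fsub1set => gB.
rewrite partial_sumE (big_fsetD1 g)//= big1_fset ?addr0// => i.
by rewrite !inE => /andP[ig _] _; exact: F0.
Qed.

Section Lambda.
Variables (R : realType) (G : groupType).
Local Notation A := (bop R G).

Lemma lambdaE (g : G) (x : ell2 R G) h : lambda R g x h = x (g^-1 * h)%g.
Proof. by []. Qed.

Lemma bop_eq (S T : A) : (forall x h, S x h = T x h) -> S = T.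
Proof. by move=> ST; apply/val_inj/funext => x; apply/val_inj/funext => h; exact: ST. Qed.

Lemma lambdaM (g h : G) : lambda R (g * h)%g = lambda R g * lambda R h.
Proof.
apply: bop_eq => x k; rewrite -[(lambda R g * _) x]/(lambda R g (lambda R h x)) !lambdaE.
by rewrite invgM mulgA.
Qed.

Lemma lambda1 : lambda R (1%g : G) = 1.
Proof. by apply: bop_eq => x k; rewrite lambdaE invg1 mul1g. Qed.

Lemma opnorm_lambda (g : G) : opnorm (lambda R g) <= 1.
Proof. by apply: opnorm_le => // x; rewrite mul1r /rnorm /= lambda_sqnorm. Qed.

Lemma inner_delta (g : G) (z : ell2 R G) : inner (ell2_delta R g) z = ((z g)^*)%C.
Proof.
rewrite /inner (@sum_single _ _ _ g) => [|i ig].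
  by rewrite -[ell2_delta R g g]/((g == g)%:R) eqxx mul1r.
by rewrite -[ell2_delta R g i]/((i == g)%:R) (negbTE ig) mul0r.
Qed.

(** Pairing with the delta functions recovers the coordinates of a vector, so there is
at most one adjoint. *)
Lemma adjoint_lambda (g : G) : adjoint (lambda R g) = lambda R g^-1%g.
Proof.
have adj x y : inner (lambda R g x) y = inner x (lambda R g^-1%g y).
  rewrite /inner; set F := fun k => _.
  rewrite -(@sum_reindex _ _ _ F (fun k => g * k)%g (fun k => g^-1 * k)%g); last 2 first.
  - by move=> k; rewrite mulKg.
  - by move=> k; rewrite mulVKg.
  by congr summability.sum; apply/funext => k; rewrite /F /= mulKg invgK.
apply: xget_unique => [//|S h].
apply: bop_eq => x k; apply: (can_inj (@conjcK R)).
by rewrite -!inner_delta -h adj.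
Qed.

End Lambda.

Section GroupAlgebraClosure.
Variables (R : realType) (G : groupType).
Local Notation A := (bop R G).
Implicit Types (H : set G) (S T : A).

Lemma cstarP H T : cstar H T <->
  forall e, 0 < e -> exists2 S, lambda_span H S & opnorm (T - S) < e.
Proof.
split=> [clT e e0|ap B /nbhs_ballP[e /= e0 eB]].
  have [|S [HS]] := clT [set S | `|T - S| < e%:C%C].
    apply/nbhs_ballP; exists e%:C%C; first by rewrite /= ltcR.
    by move=> S; rewrite -ball_normE.
  by rewrite /= normbE ltcR; exists S.
have eE : e = (complex.Re e)%:C%C by case: e {eB} e0 => a b; rewrite ltcE /= => /andP[/eqP->].
rewrite eE ltcR in e0.
have [S HS TS] := ap _ e0; exists S; split=> //; apply: eB.
by rewrite -ball_normE /= eE normbE ltcR.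
Qed.

Lemma span_cstar H T : lambda_span H T -> cstar H T.
Proof. by move=> HT; apply/cstarP => e e0; exists T; rewrite // subrr opnorm0. Qed.

Lemma cstar_sub H H' T : H `<=` H' -> cstar H T -> cstar H' T.
Proof.
move=> HH' /cstarP ap; apply/cstarP => e /ap[S [s sH ->] Se].
by exists (\sum_(p <- s) p.1 *: lambda R p.2) => //; exists s => // p /sH /HH'.
Qed.

Lemma cstar_lambda H g : H g -> cstar H (lambda R g).
Proof.
move=> Hg; apply: span_cstar; exists [:: (1, g)]; last by rewrite big_seq1 scale1r.
by move=> p; rewrite inE => /eqP ->.
Qed.

Lemma span_add H S T : lambda_span H S -> lambda_span H T -> lambda_span H (S + T).
Proof.
move=> [s sH ->] [t tH ->]; exists (s ++ t); last by rewrite big_cat.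
by move=> p; rewrite mem_cat => /orP[/sH|/tH].
Qed.

Lemma span_mul H S T : (forall g h, H g -> H h -> H (g * h)%g) ->
  lambda_span H S -> lambda_span H T -> lambda_span H (S * T).
Proof.
move=> HM [s sH ->] [t tH ->].
exists [seq (p.1 * q.1, (p.2 * q.2)%g) | p <- s, q <- t].
  by move=> _ /allpairsP[[p q] [/= ps qt ->]] /=; apply: HM; [exact: sH|exact: tH].
rewrite big_allpairs_dep /= mulr_suml; apply: eq_bigr => p _.
rewrite mulr_sumr; apply: eq_bigr => q _ /=.
by rewrite lambdaM -scalerAl -scalerAr scalerA.
Qed.

Lemma cstar_add H S T : cstar H S -> cstar H T -> cstar H (S + T).
Proof.
move=> /cstarP aS /cstarP aT; apply/cstarP => e e0.
have e2 : 0 < e / 2 by rewrite divr_gt0.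
have [S' HS' dS] := aS _ e2; have [T' HT' dT] := aT _ e2.
exists (S' + T'); first exact: span_add.
rewrite opprD addrACA (le_lt_trans (opnormD _ _))//; lra.
Qed.

Lemma cstar_mul H S T : (forall g h, H g -> H h -> H (g * h)%g) ->
  cstar H S -> cstar H T -> cstar H (S * T).
Proof.
move=> HM /cstarP aS /cstarP aT; apply/cstarP => e e0.
pose K := opnorm S + opnorm T + 1.
have S0 := opnorm_ge0 S; have T0 := opnorm_ge0 T.
have K0 : 0 < K by rewrite ltr_wpDl// addr_ge0.
pose d := Num.min 1 (e / K).
have d0 : 0 < d by rewrite lt_min ltr01 divr_gt0.
have [d1 dK] : d <= 1 /\ d * K <= e.
  by rewrite -ler_pdivlMr//; split; rewrite ge_min lexx ?orbT.
have [S' HS' dS] := aS _ d0; have [T' HT' dT] := aT _ d0.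
exists (S' * T'); first exact: span_mul.
have -> : S * T - S' * T' = S * (T - T') + (S - S') * T'.
  by rewrite mulrBr mulrBl addrA subrK.
have T'1 : opnorm T' <= opnorm T + 1.
  have -> : T' = T - (T - T') by rewrite subKr.
  rewrite (le_trans (opnormD _ _))// opnormN lerD2l; lra.
apply: le_lt_trans (opnormD _ _) _.
have h1 : opnorm (S * (T - T')) <= opnorm S * d.
  by rewrite (le_trans (opnormM _ _))// ler_wpM2l// ltW.
have h2 : opnorm ((S - S') * T') < d * (opnorm T + 1).
  apply: le_lt_trans (opnormM _ _) _; apply: (@le_lt_trans _ _ (opnorm (S - S') * (opnorm T + 1))).
    by rewrite ler_wpM2l// opnorm_ge0.
  by rewrite ltr_pM2r// ltr_wpDl.
apply: lt_le_trans dK; rewrite /K; move: h1 h2; set a := opnorm (_ * _); set b := opnorm (_ * _).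
by set p := opnorm S; set q := opnorm T => *; lra.
Qed.

Lemma opnorm_conj g T : opnorm (lambda R g * T * lambda R g^-1%g) <= opnorm T.
Proof.
apply: le_trans (opnormM _ _) _.
apply: (@le_trans _ _ (opnorm (lambda R g * T) * 1)).
  by rewrite ler_wpM2l ?opnorm_ge0// opnorm_lambda.
rewrite mulr1; apply: le_trans (opnormM _ _) _.
by rewrite ler_piMl ?opnorm_ge0// opnorm_lambda.
Qed.

Lemma cstar_conj H g T : (forall h, H h -> H (g * h * g^-1)%g) ->
  cstar H T -> cstar H (lambda R g * T * lambda R g^-1%g).
Proof.
move=> HJ /cstarP aT; apply/cstarP => e e0; have [S [s sH SE] dS] := aT _ e0.
exists (lambda R g * S * lambda R g^-1%g); last first.
  by rewrite -mulrBl -mulrBr (le_lt_trans (opnorm_conj _ _)).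
exists [seq (p.1, (g * p.2 * g^-1)%g) | p <- s].
  by move=> _ /mapP[p ps ->] /=; apply: HJ; exact: sH.
rewrite big_map SE mulr_sumr mulr_suml; apply: eq_bigr => p _ /=.
by rewrite !lambdaM -scalerAr -scalerAl.
Qed.

End GroupAlgebraClosure.

(** * Moments and cumulants of x *)

Section CrossedProduct.
Variables (R : realType) (Lam : zmodType).
Local Notation G := (semidirect Lam).
Local Notation A := (bop R G).
Local Notation L := (@Lgrp Lam).

Lemma LgrpM (g h : G) : L g -> L h -> L (g * h)%g.
Proof. by move=> g0 h0; change (g.2 + h.2 = 0); rewrite g0 h0 addr0. Qed.

Lemma LgrpJ (g h : G) : L h -> L (g * h * g^-1)%g.
Proof.
by move=> h0; change (g.2 + h.2 - g.2 = 0); rewrite h0 addr0 subrr.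
Qed.

Definition shiftg (k : int) : G := (0, k).

Lemma shiftgD k l : shiftg (k + l) = (shiftg k * shiftg l)%g.
Proof.
change ((0, k + l) = (0 + dirsum_shift k 0, k + l) :> dirsum Lam * int).
by congr pair; rewrite add0r; apply/val_inj/funext.
Qed.

Lemma shiftgN k : shiftg (- k) = (shiftg k)^-1%g.
Proof.
apply: (@mulgI _ (shiftg k)).
by rewrite -shiftgD subrr mulgV.
Qed.

Definition upow (k : int) : A := lambda R (shiftg k).

Lemma upowD k l : upow (k + l) = upow k * upow l. Proof. by rewrite /upow shiftgD lambdaM. Qed.
Lemma upow0 : upow 0 = 1. Proof. exact: lambda1. Qed.
Lemma upowK k : upow k * upow (- k) = 1. Proof. by rewrite -upowD subrr upow0. Qed.
Lemma upowNK k : upow (- k) * upow k = 1. Proof. by rewrite -upowD addNr upow0. Qed.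

Lemma uopE : uop R Lam = upow 1. Proof. by []. Qed.
Lemma adjoint_uop : adjoint (uop R Lam) = upow (-1).
Proof. by rewrite adjoint_lambda /upow shiftgN. Qed.

Local Notation B0 := (@calB0 R Lam).
Local Notation A0 := (@calA0 R Lam).

Lemma calA0M a b : A0 a -> A0 b -> A0 (a * b).
Proof. exact: cstar_mul. Qed.
Lemma calB0M a b : B0 a -> B0 b -> B0 (a * b).
Proof. by apply: cstar_mul; exact: LgrpM. Qed.
Lemma calB0A0 b : B0 b -> A0 b.
Proof. exact: cstar_sub. Qed.
Lemma calB0_1 : B0 1.
Proof. by rewrite -upow0; exact: cstar_lambda. Qed.
Lemma calA0_upow k : A0 (upow k).
Proof. exact: cstar_lambda. Qed.
Lemma calB0J k b : B0 b -> B0 (upow k * b * upow (- k)).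
Proof. by rewrite /upow shiftgN; apply: cstar_conj => h; exact: LgrpJ. Qed.

Lemma alphaE b : alpha b = upow 1 * b * upow (-1).
Proof. by rewrite /alpha uopE adjoint_uop. Qed.

(** Conjugation by u^-1 preserves the algebra of the normal subgroup, so [b] is in the
image of [alpha], where the partial inverse is a true one. *)
Lemma alpha_invE b : B0 b -> alpha_inv b = upow (-1) * b * upow 1.
Proof.
move=> Bb; have inj : {in B0 &, injective (@alpha R Lam)}.
  move=> b1 b2 _ _; rewrite !alphaE => e.
  have : upow (-1) * (upow 1 * b1 * upow (-1)) * upow 1 =
    upow (-1) * (upow 1 * b2 * upow (-1)) * upow 1 by rewrite e.
  by rewrite !mulrA upowNK !mul1r -!mulrA upowNK !mulr1.
have Bc : B0 (upow (-1) * b * upow 1) by have := @calB0J (-1) _ Bb; rewrite opprK.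
have {1}-> : b = alpha (upow (-1) * b * upow 1).
  by rewrite alphaE !mulrA upowK mul1r -!mulrA upowK mulr1.
rewrite /alpha_inv pinvKV//; exact: mem_set.
Qed.

Variables (E : A -> A).
Hypothesis hE : is_cond_exp L E.

Definition uletter (f : bool -> A) :=
  exists d b, [/\ B0 d, B0 b & f = fun e => d * upow (step true e) * b].

(** Moving the powers of u to the right conjugates the coefficients, which stay in the
algebra of the normal subgroup. *)
Lemma prod_uletter n (f : 'I_n -> bool -> A) (T : {set 'I_n}) (l : seq 'I_n) :
  (forall i, uletter (f i)) ->
  exists2 b, B0 b & \prod_(i <- l) f i (i \in T) =
    b * upow (height true [seq i \in T | i <- l]).
Proof.
move=> fA; elim: l => [|i l [b Bb IH]].
  by exists 1; [exact: calB0_1|rewrite big_nil /height big_nil mul1r upow0].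
have [d [c [Bd Bc fE]]] := fA i.
set k := step true (i \in T).
exists (d * (upow k * (c * b) * upow (- k))).
  by apply: calB0M => //; apply: calB0J; exact: calB0M.
rewrite big_cons IH fE height_cons -/k upowD !mulrA; congr (_ * _).
by rewrite -!mulrA upowNK mulr1.
Qed.

Lemma cond_exp_upow b k : B0 b -> E (b * upow k) = if k == 0 then b else 0.
Proof.
move=> Bb; have := cond_exp_bimod hE Bb (@calA0_upow k) calB0_1; rewrite !mulr1 => ->.
case: eqP => [->|k0]; first by rewrite (cond_exp_in hE)// -/(upow 0) upow0 mulr1.
by rewrite (cond_exp_out hE) ?mulr0.
Qed.

Lemma cond_exp_sum I (s : seq I) (P : pred I) (F : I -> A) :
  (forall i, A0 (F i)) -> E (\sum_(i <- s | P i) F i) = \sum_(i <- s | P i) E (F i).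
Proof.
move=> FA.
have A00 : A0 0 by apply: span_cstar; exists [::] => //; rewrite big_nil.
have E0 : E 0 = 0.
  by have := cond_exp_linear hE (-1) A00 A00; rewrite scaler0 addr0 scaleN1r addNr.
suff [] : A0 (\sum_(i <- s | P i) F i) /\ E (\sum_(i <- s | P i) F i) = \sum_(i <- s | P i) E (F i) by [].
elim/big_rec2: _ => [//|i a c _ [Ac <-]]; split; first (apply: cstar_add => //; exact: FA).
by have := cond_exp_linear hE 1 (FA i) Ac; rewrite !scale1r.
Qed.

Lemma moment_uletter n (f : 'I_n -> bool -> A) : (0 < n)%N -> (forall i, uletter (f i)) ->
  E (\prod_(i < n) (f i true + f i false)) =
    \sum_(T : {set 'I_n}) prodw f T [set: 'I_n]%SET *~
      ((height true (word T [set: 'I_n]%SET) == 0)%:R).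
Proof.
move=> n0 fA; rewrite bigA_distr cond_exp_sum => [|T].
  apply: eq_bigr => T _.
  have [b Bb bE] := prod_uletter T (enum [set: 'I_n]%SET) fA.
  have -> : \prod_(i < n) (if i \in T then f i true else f i false) = prodw f T [set: 'I_n]%SET.
    by rewrite prodw_setT; apply: eq_bigr => i _; case: (i \in T).
  rewrite /prodw bE cond_exp_upow// /word; case: eqP => [->|_]; last by rewrite mulr0z.
  by rewrite upow0 mulr1 mulr1z.
have [b Bb bE] := prod_uletter T (enum [set: 'I_n]%SET) fA.
have -> : \prod_(i < n) (if i \in T then f i true else f i false) = prodw f T [set: 'I_n]%SET.
  by rewrite prodw_setT; apply: eq_bigr => i _; case: (i \in T).
by rewrite /prodw bE; apply: calA0M; [exact: calB0A0|exact: calA0_upow].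
Qed.

Lemma uletter_sum f : uletter f -> A0 (f true + f false).
Proof.
move=> [d [b [Bd Bb ->]]]; apply: cstar_add; apply: calA0M; try exact: calB0A0;
  apply: calA0M; [exact: calB0A0|exact: calA0_upow|exact: calB0A0|exact: calA0_upow].
Qed.

Lemma uletterMr f c : uletter f -> B0 c -> uletter (fun e => f e * c).
Proof.
move=> [d [b [Bd Bb ->]]] Bc; exists d, (b * c); split => //; first exact: calB0M.
by apply/funext => e; rewrite mulrA.
Qed.

Lemma uletterMl f c : uletter f -> B0 c -> uletter (fun e => c * f e).
Proof.
move=> [d [b [Bd Bb ->]]] Bc; exists (c * d), b; split => //; first exact: calB0M.
by apply/funext => e; rewrite !mulrA.
Qed.

Variable kappa : seq A -> A.
Hypothesis hkappa : is_free_cumulants A0 B0 E kappa.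

(** For even [n] the alternating words have odd length and weight 0. *)
Lemma cumulant_of_x n b : B0 b ->
  Rtransform_term kappa (uop R Lam + adjoint (uop R Lam)) b n =
    (if odd n then (alpha b * b) ^+ n./2 * alpha b + (alpha_inv b * b) ^+ n./2 * alpha_inv b
     else 0) *~ signed_ballot n 0.
Proof.
move=> Bb; rewrite uopE adjoint_uop.
pose f := @rtransform_letter _ (fun e => upow (step true e)) b n.
have fA i : uletter (f i).
  exists 1, (if i == ord_max then 1 else b); split; first exact: calB0_1.
    by case: ifP => // _; exact: calB0_1.
  by apply/funext => e; rewrite mul1r.
have := @cumulantE _ _ _ _ _ _ (fun s => (height true s == 0)%:R) _ hkappa
  uletter_sum uletterMr uletterMl moment_uletter (fun n T => ncsum_alt_weight T _)
  _ (ltn0Sn n) f fA.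
rewrite sum_alt_weight//.
have -> : [seq f i true + f i false | i <- enum 'I_n.+1] =
    rcons (nseq n ((upow 1 + upow (-1)) * b)) (upow 1 + upow (-1)).
  rewrite enum_ordSr map_rcons -map_comp; congr rcons; last first.
    by rewrite /f /rtransform_letter eqxx !mulr1.
  rewrite -[in RHS](size_enum_ord n); elim: (enum 'I_n) => //= i s ->; congr cons.
  rewrite /f /rtransform_letter ifF ?mulrDl//; apply/negP => /eqP/(congr1 val) /= e.
  by have := ltn_ord i; rewrite e ltnn.
rewrite /Rtransform_term => ->; case: ifP => on; last first.
  by rewrite signed_ballot_even ?addn0 ?on// !mulr0z.
have nE : n = n./2.*2.+1 by rewrite -[LHS]odd_double_half on.
congr (_ *~ _); rewrite /f {f fA}; move: (n./2) nE => k -> {on}.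
rewrite !prodw_rtransform_letter alphaE alpha_invE// /=.
by rewrite !mulrA.
Qed.

End CrossedProduct.

(** * The Catalan series of an operator *)

Section CatalanSeries.
Variables (R : realType) (G : groupType).
Local Notation A := (bop R G).
Implicit Types (S T : A).

Lemma normc_real (x : R) : normc (x%:C)%C = `|x|.
Proof. by rewrite /= expr0n /= addr0 sqrtr_sqr. Qed.

Lemma normc_sign m : normc ((-1) ^+ m : R[i]) = 1.
Proof. by rewrite -signr_odd; case: (odd m); rewrite ?expr0 ?expr1 ?normcN normc1. Qed.

Lemma catalanE m : catalan R m = (catn R m)%:C%C.
Proof. by rewrite /catalan /catn rmorphM /= fmorphV /= !rmorph_nat. Qed.

Lemma opnorm_nat n : opnorm (n%:R : A) <= n%:R.
Proof.
elim: n => [|n IH]; first by rewrite opnorm0.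
by rewrite -natr1 -[in leRHS]natr1 (le_trans (opnormD _ _))// lerD// opnorm1.
Qed.

Lemma eps_opnorm_eq0 T (K : R) : 0 <= K -> (forall e, 0 < e -> opnorm T <= K * e) -> T = 0.
Proof.
move=> K0 TK; apply: opnorm_eq0; apply/ler_addgt0Pr => e e0; rewrite add0r.
have K1 : 0 < K + 1 by rewrite ltr_wpDl.
have := TK (e / (K + 1)); rewrite divr_gt0// => /(_ isT)/le_trans; apply.
rewrite mulrCA; apply: ler_piMr; first exact: ltW.
by rewrite ler_pdivrMr// mul1r lerDl.
Qed.

Variable c : A.
Hypothesis c_small : 4 * opnorm c < 1.
Let q := opnorm c.
Let q0 : 0 <= q. Proof. exact: opnorm_ge0. Qed.

Definition cterm m : A := ((-1) ^+ m * catalan R m) *: c ^+ m.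

Lemma opnorm_cterm m : opnorm (cterm m) <= catn R m * q ^+ m.
Proof.
rewrite opnormZ normcM normc_sign mul1r catalanE normc_real ger0_norm ?catn_ge0//.
by rewrite ler_wpM2l ?catn_ge0// opnormX.
Qed.

Lemma catn_pow m : catn R m * q ^+ m = catn R m * 4^-1 ^+ m * (4 * q) ^+ m.
Proof. by rewrite exprMn mulrA -(mulrA (catn R m)) -exprMn mulVf// expr1n mulr1. Qed.

Lemma cterm_weight m : 0 <= catn R m * 4^-1 ^+ m.
Proof. by rewrite mulr_ge0 ?catn_ge0// exprn_ge0// invr_ge0. Qed.

Lemma opnorm_c4 : 0 <= 4 * q < 1. Proof. by rewrite c_small mulr_ge0. Qed.

Lemma opnorm_cterm4 m : opnorm (cterm m) <= catn R m * 4^-1 ^+ m * (4 * q) ^+ m.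
Proof. by rewrite -catn_pow opnorm_cterm. Qed.

Lemma catalan_series : exists T, series cterm @ \oo --> T.
Proof.
apply: (@bop_series _ _ _ 2 (4 * q)) => //; first exact: opnorm_c4.
move=> k; apply: le_trans (opnorm_cterm4 k) _; rewrite ler_wpM2r ?exprn_ge0 ?mulr_ge0//.
apply: le_trans (catn_sum_le _ k.+1); rewrite big_ord_recr /= lerDr.
by apply: sumr_ge0 => i _; exact: cterm_weight.
Qed.

Lemma opnorm_series M : opnorm (series cterm M) <= 2.
Proof.
rewrite /series /= big_mkord (le_trans (opnorm_sum _ _ _))//.
apply: le_trans (catn_sum_le _ M); apply: ler_sum => m _.
apply: le_trans (opnorm_cterm4 m) _; rewrite ler_piMr ?cterm_weight//.
by apply: exprn_ile1; [rewrite mulr_ge0|exact: ltW].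
Qed.

Lemma cterm_conv m : \sum_(i < m.+1) cterm i * cterm (m - i) =
  ((-1) ^+ m * catalan R m.+1) *: c ^+ m.
Proof.
rewrite catalanE -catn_conv rmorph_sum mulr_sumr scaler_suml; apply: eq_bigr => i _.
have im : (i <= m)%N by rewrite -ltnS.
rewrite /cterm -scalerAl -scalerAr scalerA -exprD subnKC//; congr (_ *: _).
by rewrite !catalanE [in RHS]rmorphM mulrACA -exprD subnKC.
Qed.

(** Segner's recurrence turns the fixed point equation T = 1 - c T^2 into an identity
of partial sums, in which the square is truncated at total degree [M]. *)
Lemma series_fixpoint M : series cterm M.+1 =
  1 - c * \sum_(i < M) \sum_(j < M - i) cterm i * cterm j.
Proof.
rewrite -(sum_triangle (fun i j => cterm i * cterm j)) /series /= big_mkord big_ord_recl.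
congr (_ + _); first by rewrite /cterm catalanE catn0 !expr0 mulr1 scale1r.
rewrite -mulrN -sumrN mulr_sumr; apply: eq_bigr => m _.
rewrite cterm_conv /cterm /bump /= ?add1n exprS mulN1r mulNr scaleNr mulrN -scalerAr.
by rewrite exprS.
Qed.

(** The truncation drops the products of total degree at least [M] only. *)
Lemma series_square M : opnorm (series cterm M * series cterm M -
   \sum_(i < M) \sum_(j < M - i) cterm i * cterm j) <= 4 * (4 * q) ^+ M.
Proof.
have -> : series cterm M * series cterm M -
   \sum_(i < M) \sum_(j < M - i) cterm i * cterm j =
   \sum_(i < M) \sum_(j < M | ~~ (j < M - i)%N) cterm i * cterm j.
  rewrite /series /= big_mkord mulr_suml -sumrB; apply: eq_bigr => i _.
  rewrite (big_ord_widen M (fun j => cterm i * cterm j)) ?leq_subr// mulr_sumr.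
  by rewrite (bigID (fun j : 'I_M => (j < M - i)%N)) /= [X in X - _]addrC addrK.
pose a m := catn R m * 4^-1 ^+ m.
have := opnorm_c4 => /andP[p0 p1]; have p1' := ltW p1.
apply: (@le_trans _ _ (\sum_(i < M) \sum_(j < M) a i * a j * (4 * q) ^+ M)).
  apply: le_trans (opnorm_sum _ _ _) _; apply: ler_sum => i _.
  apply: le_trans (opnorm_sum _ _ _) _.
  rewrite [leRHS](bigID (fun j : 'I_M => ~~ (j < M - i)%N)) /= -[leLHS]addr0.
  apply: lerD; last first.
    by apply: sumr_ge0 => j _; rewrite mulr_ge0 ?exprn_ge0// mulr_ge0 ?cterm_weight.
  apply: ler_sum => j; rewrite -leqNgt leq_subLR => Mij.
  apply: (@le_trans _ _ (a i * a j * (4 * q) ^+ (i + j))); last first.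
    by rewrite ler_wpM2l ?mulr_ge0 ?cterm_weight//; apply: ler_wiXn2l.
  apply: le_trans (opnormM _ _) _; rewrite exprD mulrACA.
  by apply: ler_pM; rewrite ?opnorm_ge0// opnorm_cterm4.
under eq_bigr do rewrite -mulr_suml -mulr_sumr.
rewrite -mulr_suml -mulr_suml ler_wpM2r ?exprn_ge0//.
have -> : 4 = 2 * 2 :> R by rewrite -natrM.
have s0 : 0 <= \sum_(i < M) a i by apply: sumr_ge0 => i _; exact: cterm_weight.
by apply: ler_pM => //; exact: catn_sum_le.
Qed.

Variable T : A.
Hypothesis cT : series cterm @ \oo --> T.

Lemma opnorm_catalan : opnorm T <= 2.
Proof.
apply/ler_addgt0Pr => e e0; have /bop_cvgP/(_ e e0)[N /(_ N (leqnn N)) TN] := cT.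
have -> : T = (T - series cterm N) + series cterm N by rewrite subrK.
apply: le_trans (opnormD _ _) _; rewrite addrC; apply: lerD; last exact: ltW.
exact: opnorm_series.
Qed.

Lemma catalan_comm S : S * c = c * S -> S * T = T * S.
Proof.
move=> Sc; apply/eqP; rewrite -subr_eq0; apply/eqP.
have SS M : S * series cterm M = series cterm M * S.
  rewrite /series /= mulr_sumr mulr_suml; apply: eq_bigr => m _.
  rewrite /cterm -scalerAl -scalerAr; congr (_ *: _).
  by apply: commrX.
apply: (@eps_opnorm_eq0 _ (2 * opnorm S)); first by rewrite mulr_ge0 ?opnorm_ge0.
move=> e e0; have /bop_cvgP/(_ e e0)[N /(_ N (leqnn N)) TN] := cT.
have -> : S * T - T * S = S * (T - series cterm N) - (T - series cterm N) * S.
  by rewrite mulrBr mulrBl SS opprB addrA subrK.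
apply: le_trans (opnormD _ _) _; rewrite opnormN -mulrA mulr_natl mulr2n; apply: lerD.
  by apply: le_trans (opnormM _ _) _; rewrite ler_wpM2l ?opnorm_ge0// ltW.
by apply: le_trans (opnormM _ _) _; rewrite mulrC ler_wpM2l ?opnorm_ge0// ltW.
Qed.

Lemma catalan_eq : T + c * T * T = 1.
Proof.
apply/eqP; rewrite -subr_eq0; apply/eqP.
(* 1 for the series itself; 2 + 2 for the two factors of norm at most 2, and 4
   for the truncation of the square *)
apply: (@eps_opnorm_eq0 _ (1 + q * 8)); first by rewrite addr_ge0 ?mulr_ge0.
move=> e e0; have /bop_cvgP/(_ e e0)[N TN] := cT.
have [M NM qM] := pow_small N opnorm_c4 (ler0n R 4) (mulr_gt0 (ltr0n R 4) e0).
pose S := series cterm M; pose W := \sum_(i < M) \sum_(j < M - i) cterm i * cterm j.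
have hS : opnorm (T - S) <= e by apply/ltW/TN.
have hS' : opnorm (T - series cterm M.+1) <= e by apply/ltW/TN; rewrite leqW.
have -> : T + c * T * T - 1 =
   (T - series cterm M.+1) + c * ((T * (T - S) + (T - S) * S) + (S * S - W)).
  have -> : T * (T - S) + (T - S) * S + (S * S - W) = T * T - W.
    by rewrite mulrBr mulrBl !addrA !subrK.
  rewrite series_fixpoint -/W mulrBr opprB [c * W - 1]addrC addrA.
  rewrite mulrA -!addrA; congr (_ + _); rewrite addrC; congr (_ + _).
  by rewrite addrCA subrr addr0.
have hT := opnorm_catalan; have hSM : opnorm S <= 2 := opnorm_series M.
apply: le_trans (opnormD _ _) _; rewrite [leRHS]mulrDl mul1r; apply: lerD => //.
apply: le_trans (opnormM _ _) _; rewrite -/q -mulrA ler_wpM2l//.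
have -> : 8 * e = (2 * e + e * 2) + 4 * e by ring.
apply: le_trans (opnormD _ _) _; apply: lerD.
  apply: le_trans (opnormD _ _) _; apply: lerD; apply: le_trans (opnormM _ _) _;
    by apply: ler_pM; rewrite ?opnorm_ge0.
exact: le_trans (series_square M) (ltW qM).
Qed.
End CatalanSeries.

(** * The principal square root and the functional calculus *)

Lemma re_sqrtc_ge0 (R : rcfType) (z : R[i]) : 0 <= complex.Re (sqrtc z).
Proof. by case: z => a b /=; rewrite sqrtr_ge0. Qed.

Section SqrtContinuity.
Variable R : realType.

Lemma re_sqrtc_gt0 (z : R[i]) : 0 < complex.Re z -> 0 < complex.Re (sqrtc z).
Proof.
move=> z0; rewrite lt_def re_sqrtc_ge0 andbT; apply: contraTneq z0 => s0.
have := sqr_sqrtc z; case: (sqrtc z) s0 => a b /= -> <-.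
by rewrite expr2 /= mulr0 sub0r oppr_gt0 -leNgt -expr2 sqr_ge0.
Qed.

(** If s and s' are the roots of z and z' then (s - s') (s + s') = z - z', and the
second factor is at least the real part of s, which is positive. *)
Lemma sqrtc_continuous (z : R[i]^o) : 0 < complex.Re (z : R[i]) ->
  {for z, continuous (@sqrtc R : R[i]^o -> R[i]^o)}.
Proof.
move=> z0; set s := sqrtc z; have s0 : 0 < complex.Re s by exact: re_sqrtc_gt0.
apply/(@cvgrPdist_lt _ R[i]^o _ (nbhs z)) => e e0.
have eE : e = (complex.Re e)%:C%C by case: e e0 => a b; rewrite ltcE /= => /andP[/eqP->].
rewrite eE ltcR in e0.
have d0 : 0 < (complex.Re e * complex.Re s)%:C%C :> R[i] by rewrite ltcR mulr_gt0.
apply/nbhs_ballP; exists (complex.Re e * complex.Re s)%:C%C; first exact: d0.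
move=> w; rewrite -ball_normE /= => zw; rewrite eE.
change (is_true ((normc (z - w))%:C%C < (complex.Re e * complex.Re s)%:C%C)) in zw.
change (is_true ((normc (s - sqrtc w))%:C%C < (complex.Re e)%:C%C)).
rewrite !ltcR in zw *.
have h : normc (s - sqrtc w) * normc (s + sqrtc w) = normc (z - w).
  by rewrite -normcM -subr_sqr !sqr_sqrtc.
have h2 : complex.Re s <= normc (s + sqrtc w).
  apply: le_trans (normr_re_le _); apply: le_trans (ler_norm _).
  by rewrite raddfD lerDl re_sqrtc_ge0.
rewrite -(ltr_pM2r s0); apply: le_lt_trans zw; rewrite -h.
by rewrite ler_wpM2l// normc_ge0.
Qed.

Lemma addsqrtc_neq0 (z : R[i]) : 1 + sqrtc z != 0.
Proof.
apply/eqP => e; have := re_sqrtc_ge0 z.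
have -> : sqrtc z = -1 by apply/eqP; rewrite -addr_eq0 addrC e.
by rewrite raddfN /= oppr_ge0 ler10.
Qed.

Lemma addsqrtc_continuous (z : R[i]^o) : 0 < complex.Re (z : R[i]) ->
  {for z, continuous ((fun z => 1 + sqrtc z) : R[i]^o -> R[i]^o)}.
Proof.
move=> z0; apply: (@cvgD _ R[i]^o _ (nbhs z) _ (fun=> 1)); first exact: cst_continuous.
exact: sqrtc_continuous.
Qed.

Lemma inv_addsqrtc_continuous (z : R[i]^o) : 0 < complex.Re (z : R[i]) ->
  {for z, continuous ((fun z => (1 + sqrtc z)^-1) : R[i]^o -> R[i]^o)}.
Proof.
move=> z0; apply: (@cvgV R[i] _ (nbhs z) _ (fun z => 1 + sqrtc z : R[i]^o)).
  exact: addsqrtc_neq0.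
exact: addsqrtc_continuous.
Qed.

End SqrtContinuity.

Section Spectrum.
Variables (R : realType) (G : groupType).
Local Notation A := (bop R G).
Implicit Types (S T y : A).

Lemma neumann y : opnorm y < 1 -> 1 - y \is a GRing.unit.
Proof.
move=> y1; have y0 := opnorm_ge0 y.
have rr : 0 <= opnorm y < 1 by rewrite y0.
have [T TP] : exists T, series (fun k => y ^+ k) @ \oo --> T.
  by apply: (@bop_series _ _ _ 1 (opnorm y)) => // k; rewrite mul1r opnormX.
have sl n : (1 - y) * series (fun k => y ^+ k) n = 1 - y ^+ n.
  elim: n => [|n IH]; first by rewrite /series /= big_geq// mulr0 expr0 subrr.
  rewrite /series /= big_nat_recr//= mulrDr -[\sum_(_ <= _ < _) _]/(series _ n) IH.
  by rewrite mulrBl mul1r -exprS addrA subrK.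
have sr n : series (fun k => y ^+ k) n * (1 - y) = 1 - y ^+ n.
  elim: n => [|n IH]; first by rewrite /series /= big_geq// mul0r expr0 subrr.
  rewrite /series /= big_nat_recr//= mulrDl -[\sum_(_ <= _ < _) _]/(series _ n) IH.
  by rewrite mulrBr mulr1 -exprSr addrA subrK.
have small (F : A -> A) : (forall S, opnorm (F S) <= opnorm S * opnorm (1 - y)) ->
    (forall n, F (T - series (fun k => y ^+ k) n) = F T - (1 - y ^+ n)) -> F T = 1.
  move=> Fb FE; apply/eqP; rewrite -subr_eq0; apply/eqP.
  apply: (@eps_opnorm_eq0 _ _ _ (opnorm (1 - y) + 1)); first by rewrite addr_ge0 ?opnorm_ge0.
  move=> e e0; have /bop_cvgP/(_ e e0)[N TN] := TP.
  have [M NM yM] := pow_small N rr ler01 e0; rewrite mul1r in yM.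
  have -> : F T - 1 = F (T - series (fun k => y ^+ k) M) - y ^+ M.
    by rewrite FE opprB addrA addrAC addrK.
  apply: le_trans (opnormD _ _) _; rewrite opnormN mulrDl mul1r; apply: lerD.
    apply: le_trans (Fb _) _; rewrite mulrC ler_wpM2l ?opnorm_ge0//.
    exact/ltW/TN.
  by apply: le_trans (opnormX _ _) _; exact: ltW.
apply/unitrP; exists T; split.
  apply: (small (fun S => S * (1 - y))) => [S|n]; first exact: opnormM.
  by rewrite mulrBl sr.
apply: (small (fun S => (1 - y) * S)) => [S|n]; first by rewrite mulrC; exact: opnormM.
by rewrite mulrBr sl.
Qed.

(** Outside the ball, 1 + y - z is a nonzero multiple of 1 minus an operator of norm
less than 1. *)
Lemma spectrum_ball y (z : R[i]^o) : spectrum (1 + y) z -> normc (z - 1 : R[i]) <= opnorm y.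
Proof.
rewrite /spectrum /= => nu; rewrite leNgt; apply: contra nu => yz.
have w0 : (z - 1 : R[i]) != 0.
  by apply: contraTneq yz => ->; rewrite normc0 -leNgt opnorm_ge0.
have -> : 1 + y - z%:A = (- (z - 1))%:A * (1 - (z - 1)^-1 *: y).
  rewrite mulrBr mulr1 -scalerAl mul1r scalerA mulNr mulfV// scaleN1r opprK.
  by rewrite scaleNr scalerBl scale1r opprB addrAC.
rewrite unitrMr; last first.
  apply/unitrP; exists ((- (z - 1))^-1%:A).
  by rewrite -!scalerAl !mul1r !scalerA mulVf ?mulfV ?oppr_eq0// scale1r.
apply: neumann; rewrite opnormZ normcV mulrC ltr_pdivrMr ?mul1r//.
by apply: le_lt_trans yz; exact: opnorm_ge0.
Qed.

Lemma spectrum_re y (z : R[i]^o) : opnorm y < 1 -> spectrum (1 + y) z -> 0 < complex.Re (z : R[i]).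
Proof.
move=> y1 /spectrum_ball zy.
have := le_lt_trans (le_trans (normr_re_le _) zy) y1.
by rewrite raddfB /= ltr_norml => /andP[]; lra.
Qed.

Lemma sqrtc_within y : opnorm y < 1 ->
  {within spectrum (1 + y), continuous (@sqrtc R : R[i]^o -> R[i]^o)}.
Proof.
move=> y1; apply: continuous_in_subspaceT => z; rewrite inE => zs.
by apply: sqrtc_continuous; exact: spectrum_re zs.
Qed.

Lemma normc_inv_le1 (z : R[i]) : 0 <= complex.Re z -> normc (1 + z)^-1 <= 1.
Proof.
move=> z0; have h : 1 <= normc (1 + z).
  apply: le_trans (normr_re_le _); rewrite raddfD /=; apply: le_trans (ler_norm _).
  by rewrite lerDl.
by rewrite normcV invf_le1// (lt_le_trans ltr01).
Qed.

Variable c : A.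
Hypothesis c_small : 4 * opnorm c < 1.
Variable T : A.
Hypothesis cT : series (cterm c) @ \oo --> T.

Lemma opnorm_mul4 (S : A) : opnorm (4 * S) <= 4 * opnorm S.
Proof.
apply: le_trans (opnormM _ _) _; rewrite ler_wpM2r ?opnorm_ge0//.
exact: opnorm_nat.
Qed.

(** With [r] for 2 c T, both the square root [s] of the functional calculus and 1 + r
are square roots of 1 + 4 c, and they commute. Their difference [d] is the
product of - d r with the inverse of 1 + s, which is the image of the function
1 / (1 + sqrt z) of modulus at most 1; as [r] has norm less than 1, [d] vanishes. *)
Lemma sqrt_calculus (Phi : (R[i]^o -> R[i]^o) -> A) :
  is_functional_calculus (1 + 4 * c) Phi ->
  1 + Phi (@sqrtc R) \is a GRing.unit /\ T * (1 + Phi (@sqrtc R)) = 2.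
Proof.
move=> hPhi; set s := Phi _.
have c4 : opnorm (4 * c) < 1 := le_lt_trans (opnorm_mul4 c) c_small.
have csq := sqrtc_within c4; set D := spectrum _ in csq.
have cid : {within D, continuous (fun z : R[i]^o => z)}.
  by apply: continuous_subspaceT => z; exact: cvg_id.
have c1 : {within D, continuous (fun _ : R[i]^o => 1 : R[i]^o)}.
  by apply: continuous_subspaceT; exact: cst_continuous.
pose g (z : R[i]^o) : R[i]^o := (1 + sqrtc z)^-1.
pose h (z : R[i]^o) : R[i]^o := 1 * 1 + sqrtc z.
have hE : Phi h = 1 + s by rewrite (fcalc_linear hPhi 1 c1 csq) scale1r (fcalc_one hPhi).
have cg : {within D, continuous g}.
  apply: continuous_in_subspaceT => z; rewrite inE => zs.
  by apply: inv_addsqrtc_continuous; exact: spectrum_re zs.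
have hh : h = (fun z => 1 + sqrtc z) by apply/funext => z; rewrite /h mul1r.
have ch : {within D, continuous h}.
  rewrite hh; apply: continuous_in_subspaceT => z; rewrite inE => zs.
  by apply: addsqrtc_continuous; exact: spectrum_re zs.
have hg : (1 + s) * Phi g = 1.
  rewrite -hE -(fcalc_mul hPhi ch cg) -(fcalc_one hPhi); congr Phi.
  by apply/funext => z; rewrite hh /g mulfV ?addsqrtc_neq0.
have gh : Phi g * (1 + s) = 1.
  rewrite -hE -(fcalc_mul hPhi cg ch) -(fcalc_one hPhi); congr Phi.
  by apply/funext => z; rewrite hh /g mulVf ?addsqrtc_neq0.
have ss : s * s = 1 + 4 * c.
  rewrite -(fcalc_mul hPhi csq csq) -[RHS](fcalc_id hPhi); congr Phi.
  by apply/funext => z; rewrite -expr2 sqr_sqrtc.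
have sc : s * c = c * s.
  have : s * (1 + 4 * c) = (1 + 4 * c) * s by rewrite -ss mulrA.
  rewrite (mulrDr s 1 (4 * c)) (mulrDl 1 (4 * c) s) mulr1 mul1r => /addrI.
  rewrite mulrA (commr_nat s 4) -!mulrA !mulr_natl.
  move/(congr1 (fun X => (4^-1 : R[i]) *: X)).
  by rewrite -(scaler_nat 4 (s * c)) -(scaler_nat 4 (c * s)) !scalerA mulVf ?pnatr_eq0// !scale1r.
have sT : s * T = T * s by exact: catalan_comm cT _ sc.
have Tc : c * T = T * c by exact: catalan_comm cT _ _.
have Teq := catalan_eq c_small cT.
pose r := c * T *+ 2.
have rr : opnorm r < 1.
  apply: le_lt_trans c_small; rewrite /r mulr2n; apply: le_trans (opnormD _ _) _.
  have : opnorm (c * T) <= opnorm c * 2.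
    by apply: le_trans (opnormM _ _) _; rewrite ler_wpM2l ?opnorm_ge0// (opnorm_catalan c_small).
  by set a := opnorm (_ * _) => ?; lra.
have gle : opnorm (Phi g) <= 1.
  rewrite -lecR -normbE (fcalc_isometric hPhi cg) lecR -/D.
  have [->|/set0P[z0 z0D]] := eqVneq D set0; first by rewrite image_set0 sup0.
  apply: ge_sup; first by exists (normc (g z0)), z0.
  by move=> _ [z zD <-]; apply: normc_inv_le1; exact: re_sqrtc_ge0.
(* in terms of p the equation T + c T^2 = 1 reads c = p + p^2 *)
pose p := c * T.
have pp : p * p = c * (c * T * T) by rewrite /p !mulrA -(mulrA c T c) -Tc mulrA.
have cp : c = p + p * p by rewrite pp /p -mulrDr Teq mulr1.
have tt : (1 + r) * (1 + r) = 1 + 4 * c.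
  rewrite mulrDl mul1r mulrDr mulr1 -addrA; congr (_ + _).
  rewrite mulr_natl [in RHS]cp /r -/p mulrnAl mulrnAr -mulrnA addrA -mulrnDr.
  by rewrite mulrnDl.
have sr : s * r = r * s by rewrite /r mulrnAl mulrnAr mulrA sc -!mulrA sT.
have D0 : s - (1 + r) = 0.
  apply: opnorm_eq0; set d := s - _.
  have dst : d * (s + (1 + r)) = 0.
    have st : s * (1 + r) = (1 + r) * s by rewrite mulrDr mulrDl mulr1 mul1r sr.
    rewrite mulrBl (mulrDr s s (1 + r)) (mulrDr (1 + r) s (1 + r)) ss tt st.
    by rewrite opprD addrA addrK subrr.
  have e : d = - (d * r * Phi g).
    have : d * (1 + s) = - (d * r).
      apply/eqP; rewrite -addr_eq0 -mulrDr; apply/eqP.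
      by rewrite -[RHS]dst (addrCA s) addrA.
    move/(congr1 (fun X => X * Phi g)); by rewrite -mulrA hg mulr1 mulNr.
  have : opnorm d <= opnorm d * opnorm r.
    rewrite {1}e opnormN; apply: le_trans (opnormM _ _) _.
    apply: (@le_trans _ _ (opnorm (d * r) * 1)); first by rewrite ler_wpM2l ?opnorm_ge0.
    by rewrite mulr1 opnormM.
  have := opnorm_ge0 d; rewrite le_eqVlt => /orP[/eqP <-//|d0].
  by rewrite ler_pMr// leNgt rr.
have sE : s = 1 + r by apply/eqP; rewrite -subr_eq0 D0.
split; first by apply/unitrP; exists (Phi g).
have Tr : T * r = c * T * T *+ 2 by rewrite /r mulrnAr mulrA -Tc.
by rewrite sE (mulrDr T 1 (1 + r)) (mulrDr T 1 r) mulr1 Tr addrA -mulr2n -mulrnDl Teq.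
Qed.

End Spectrum.

(** * The R-transform of x *)

Section Main.
Variables (R : realType) (Lam : zmodType).
Local Notation A := (bop R (semidirect Lam)).
Implicit Types (b y : A).

Lemma catalan_term_split b y m :
  ((-1) ^+ m * catalan R m) *: ((y * b) ^+ m * y) = y * cterm (b * y) m.
Proof.
rewrite /cterm -scalerAr; congr (_ *: _).
elim: m => [|m IH]; first by rewrite !expr0 mulr1 mul1r.
by rewrite exprS -mulrA IH exprS !mulrA.
Qed.

Lemma series_catalan_term b n : series (catalan_term b) n =
  alpha b * series (cterm (b * alpha b)) n + alpha_inv b * series (cterm (b * alpha_inv b)) n.
Proof.
rewrite /series /= !mulr_sumr -big_split; apply: eq_bigr => m _.
by rewrite /catalan_term scalerDr !catalan_term_split.
Qed.

(** The R-transform has its nonzero terms at the odd indices. *)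
Lemma series_Rtransform_term (E : A -> A) (kappa : seq A -> A) b n :
  is_cond_exp (@Lgrp Lam) E -> is_free_cumulants (@calA0 R Lam) (@calB0 R Lam) E kappa ->
  calB0 b ->
  series (Rtransform_term kappa (uop R Lam + adjoint (uop R Lam)) b) n =
    series (catalan_term b) n./2.
Proof.
move=> hE hk Bb; elim: n => [|n IH]; first by rewrite /series /= !big_geq.
rewrite [LHS]seriesSr IH (cumulant_of_x hE hk n Bb).
case: ifP => on; last by rewrite mul0rz addr0 -uphalfE uphalf_half on.
rewrite -uphalfE uphalf_half on add1n seriesSr; congr (_ + _).
have nE : n = n./2.*2.+1 by rewrite -[LHS]odd_double_half on.
rewrite [in signed_ballot _]nE -scaler_int (signed_ballot_catn R[i]) /catalan_term.
by [].
Qed.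

End Main.

Theorem proposition5p4 (R : realType) (Lam : zmodType)
  (hLam : finitely_generated Lam)
  (E : bop R (semidirect Lam) -> bop R (semidirect Lam))
  (hE : is_cond_exp (@Lgrp Lam) E)
  (kappa : seq (bop R (semidirect Lam)) -> bop R (semidirect Lam))
  (hkappa : is_free_cumulants (@calA0 R Lam) (@calB0 R Lam) E kappa)
  (b : bop R (semidirect Lam)) (hb : calB0 b) (hb2 : `|b| < 1 / 2) :
  let x := uop R Lam + adjoint (uop R Lam) in
  [/\ cvgn (series (Rtransform_term kappa x b)),
      cvgn (series (catalan_term b)),
      Rtransform kappa x b = limn (series (catalan_term b)),
      {within spectrum (1 + 4 * b * alpha b), continuous (@sqrtc R : R[i]^o -> R[i]^o)} /\
      {within spectrum (1 + 4 * b * alpha_inv b), continuous (@sqrtc R : R[i]^o -> R[i]^o)} &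
      forall Phi Psi : (R[i]^o -> R[i]^o) -> bop R (semidirect Lam),
        is_functional_calculus (1 + 4 * b * alpha b) Phi ->
        is_functional_calculus (1 + 4 * b * alpha_inv b) Psi ->
        [/\ 1 + Phi (@sqrtc R) \is a GRing.unit,
            1 + Psi (@sqrtc R) \is a GRing.unit &
            Rtransform kappa x b =
              2 * alpha b * (1 + Phi (@sqrtc R))^-1 +
              2 * alpha_inv b * (1 + Psi (@sqrtc R))^-1]].
Proof.
move=> x.
have b2 : opnorm b < 1 / 2.
  rewrite -ltcR -normbE (_ : ((1 / 2 : R)%:C)%C = 1 / 2 :> R[i])//.
  by rewrite rmorphM /= fmorphV /= rmorph1 rmorph_nat.
have small y : opnorm y <= opnorm b -> 4 * opnorm (b * y) < 1.
  move=> yb; have b0 := opnorm_ge0 b; have y0 := opnorm_ge0 y.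
  have h1 := opnormM b y.
  have h2 : opnorm b * opnorm y <= opnorm b * opnorm b by rewrite ler_wpM2l.
  have h3 : opnorm b * opnorm b < 1 / 2 * (1 / 2).
    by apply: (@le_lt_trans _ _ (opnorm b * (1 / 2))); [rewrite ler_wpM2l// ltW|rewrite ltr_pM2r].
  lra.
have s1 : 4 * opnorm (b * alpha b) < 1.
  by apply: small; rewrite alphaE /upow (shiftgN _ 1); exact: opnorm_conj.
have s2 : 4 * opnorm (b * alpha_inv b) < 1.
  apply: small; rewrite (alpha_invE hb) /upow -{2}(opprK 1) (shiftgN _ (-1)); exact: opnorm_conj.
have [T1 T1P] := catalan_series s1; have [T2 T2P] := catalan_series s2.
set T := alpha b * T1 + alpha_inv b * T2.
have cat_cvg : series (catalan_term b) @ \oo --> T.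
  apply/bop_cvgP => e e0.
  pose K := opnorm (alpha b) + opnorm (alpha_inv b) + 1.
  have K0 : 0 < K by rewrite ltr_wpDl// addr_ge0 ?opnorm_ge0.
  have d0 : 0 < e / K by rewrite divr_gt0.
  have /bop_cvgP/(_ _ d0)[N1 N1P] := T1P; have /bop_cvgP/(_ _ d0)[N2 N2P] := T2P.
  exists (maxn N1 N2) => n; rewrite geq_max => /andP[/N1P h1 /N2P h2].
  rewrite series_catalan_term /T opprD addrACA -!mulrBr.
  apply: le_lt_trans (opnormD _ _) _.
  apply: (@le_lt_trans _ _ ((opnorm (alpha b) + opnorm (alpha_inv b)) * (e / K))).
    rewrite [leRHS]mulrDl; apply: lerD; apply: le_trans (opnormM _ _) _.
      by apply: (ler_wpM2l (opnorm_ge0 _)); exact: ltW h1.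
    by apply: (ler_wpM2l (opnorm_ge0 _)); exact: ltW h2.
  by rewrite mulrA ltr_pdivrMr// mulrC ltr_pM2l// /K ltrDl.
have R_cvg : series (Rtransform_term kappa x b) @ \oo --> T.
  apply/bop_cvgP => e e0; have /bop_cvgP/(_ _ e0)[N NP] := cat_cvg.
  exists N.*2 => n Nn; rewrite (series_Rtransform_term n hE hkappa hb); apply: NP.
  by rewrite -(half_double N) half_leq.
have R_lim : Rtransform kappa x b = T by apply: cvg_lim => //; exact: norm_hausdorff.
have e1 : 4 * b * alpha b = 4 * (b * alpha b) by rewrite mulrA.
have e2 : 4 * b * alpha_inv b = 4 * (b * alpha_inv b) by rewrite mulrA.
have small4 y : 4 * opnorm y < 1 -> opnorm (4 * y) < 1 by exact: le_lt_trans (opnorm_mul4 y).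
split.
- by apply/cvg_ex; exists T.
- by apply/cvg_ex; exists T.
- by rewrite R_lim; apply/esym/cvg_lim => //; exact: norm_hausdorff.
- by rewrite e1 e2; split; apply: sqrtc_within; exact: small4.
rewrite e1 e2 => Phi Psi hPhi hPsi.
have [u1 t1] := sqrt_calculus s1 T1P hPhi.
have [u2 t2] := sqrt_calculus s2 T2P hPsi.
split; [exact: u1|exact: u2|rewrite R_lim /T].
have key y S v : v \is a GRing.unit -> S * v = 2 -> y * S = 2 * y * v^-1.
  by move=> uv Sv; rewrite -[S](mulrK uv) Sv mulrA (commr_nat y 2).
by congr (_ + _); exact: key.
Qed.
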